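(* Let $\Delta_2=\mathrm{conv}(\mathbf 0,e_1,e_2)\subset\mathbb R^2$. Then $\mathrm{Flt}_2^{\mathbb R}(\Delta_2)=2$ and $\mathrm{Flt}_2^{\mathbb Z}(\Delta_2)=\frac{10}{3}$.
   Context: Let $A\in\{\mathbb Z,\mathbb R\}$. A convex body in $\mathbb R^d$ is a nonempty compact convex subset of $\mathbb R^d$. An $A$-unimodular transformation is a map $T:\mathbb R^d\to\mathbb R^d$, $T(x)=Mx+b$ with $M\in \mathrm{GL}_d(\mathbb Z)$ and $b\in A^d$; an $A$-unimodular copy of $X\subset\mathbb R^d$ is a set $T(X)$ for such a $T$. For $u\in(\mathbb Z^d)^*=\mathrm{Hom}(\mathbb Z^d,\mathbb Z)$ (extended linearly to $\mathbb R^d$) and $K\subset\mathbb R^d$, $\mathrm{width}_u(K)=\sup_{x,y\in K}|u(x)-u(y)|$, and the lattice width is $\mathrm{width}(K)=\inf_{u\in(\mathbb Z^d)^*\setminus\{0\}}\mathrm{width}_u(K)$. For a bounded set $X\subset\mathbb R^d$, the generalised flatness constant is $\mathrm{Flt}_d^A(X)=\sup\{\mathrm{width}(K): K\subset\mathbb R^d \text{ a convex body containing no } A\text{-unimodular copy of } X\}$. $e_1,e_2$ is the standard basis of $\mathbb Z^2$. *)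

(* Defs.v *)
From HB Require Import structures.
From mathcomp Require Import all_boot all_order all_algebra.
From mathcomp Require Import all_classical all_reals all_analysis.
Set Implicit Arguments. Unset Strict Implicit. Unset Printing Implicit Defensive.
Import Order.TTheory GRing.Theory Num.Theory.
Import numFieldNormedType.Exports.
Local Open Scope classical_set_scope.
Local Open Scope ring_scope.

Inductive coeffs := AZ | AR.

Section Defs.
Variable R : realType.

Definition pt := 'rV[R]_2.

Definition intmx {m n} (M : 'M[int]_(m, n)) : 'M[R]_(m, n) :=
  map_mx (fun z : int => z%:~R) M.

Definition convex2 (K : set pt) : Prop :=
  forall x y t, K x -> K y -> 0 <= t -> t <= 1 -> K (t *: x + (1 - t) *: y).

Definition convex_body (K : set pt) : Prop :=
  K !=set0 /\ compact K /\ convex2 K.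

Definition GL2Z (M : 'M[int]_2) : Prop :=
  exists N : 'M[int]_2, M *m N = 1%:M /\ N *m M = 1%:M.

Definition translation_ok (A : coeffs) (b : pt) : Prop :=
  match A with AZ => exists c : 'rV[int]_2, b = intmx c | AR => True end.

(* A-unimodular transformation T(x) = M x + b (x written as a row vector) *)
Definition unimod_map (M : 'M[int]_2) (b : pt) (x : pt) : pt :=
  x *m (intmx M)^T + b.

Definition contains_copy (A : coeffs) (X K : set pt) : Prop :=
  exists (M : 'M[int]_2) (b : pt), GL2Z M /\ translation_ok A b /\
    unimod_map M b @` X `<=` K.

Definition lin (u : 'rV[int]_2) (x : pt) : R := \sum_(i < 2) (u 0 i)%:~R * x 0 i.

Definition width_u (K : set pt) (u : 'rV[int]_2) : \bar R :=
  ereal_sup [set (`|lin u x - lin u y|)%:E | x in K & y in K].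

Definition lattice_width (K : set pt) : \bar R :=
  ereal_inf [set width_u K u | u in [set u : 'rV[int]_2 | u != 0]].

Definition Flt (A : coeffs) (X : set pt) : \bar R :=
  ereal_sup [set lattice_width K | K in
     [set K : set pt | convex_body K /\ ~ contains_copy A X K]].

Definition e (i : 'I_2) : pt := delta_mx 0 i.

Definition Delta2 : set pt :=
  [set x | exists a b c : R, [/\ 0 <= a, 0 <= b, 0 <= c, a + b + c = 1 &
     x = a *: (0 : pt) + b *: e ord0 + c *: e (lift ord0 ord0)]].

End Defs.

(* Main.v *)
Require Import Defs.
From HB Require Import structures.
From mathcomp Require Import all_boot all_order all_algebra.
From mathcomp Require Import all_classical all_reals all_analysis.
From mathcomp Require Import ring lra zify.
Import Order.TTheory GRing.Theory Num.Theory.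
Local Open Scope ring_scope.


(** Real translations: if the [y]-extent of the body is at most [h >= 2], either all its horizontal chords have length at most 1, and then it lies in a sheared strip of horizontal width 1, or some chord is longer.  In that case the lowest and the highest unit chord form a parallelogram; the parts of the body above and below it are confined to the strip spanned by the two chords, the rest to wedges, and since the unit chords are not edges of unimodular triangles these wedges are thin enough to give width at most [1 + h / 2] in some direction.  Iterating, the excess of the width over 2 is halved each time.

Lattice translations: a body with fewer than two lattice points can be enlarged, by convex hulls with suitably chosen lattice points, to one with exactly two, so it may be assumed to contain [(0,0)] and [(1,0)] but no lattice point at levels 1 and -1.  The body then crosses level -1 inside [(0,1)] (after shearing) and level 1 inside some [(n,n+1)]; every value of [n] gives width at most 10/3 in direction [y], [x] or [x - y].

The bounds are attained in the limit by the diamonds [|x| + |y| <= 1 - ep] and by slightly shrunk copies of the triangle with vertices [(-2,0)], [(4/3,5/3)], [(-1/3,-5/3)]. *)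

(** * Wedge inequalities *)

Section Algebra.
Variable R : realFieldType.
Implicit Types z g w y b t A B : R.

(** One mechanism underlies most estimates. If all points of the body at some level lie in a unit
    interval, the segment from a point to an apex beyond that level must cross this interval, which
    confines the point to a wedge that is thinner the farther the apex. The lowest and the highest
    point give two wedges; eliminating the level of the point bounds its overhang beyond the unit
    strip. Left and right overhangs obey the same inequalities with the apex abscissae [b], [t]
    replaced by [1 - b], [1 - t], so a bound linear in [b] and [t] controls their sum wherever the
    apexes are. For real translations the obstacle is a pair of points both beyond the levels of the
    unit chords: a shear of slope at most 1/2 then contributes up to half the height. Hence the
    estimate [1 + h / 2], with fixed point 2, instead of 2 at once. For lattice translations 10/3 is
    sharp for [n = 1]: the decisive polynomial vanishes when both extreme points are at distance 5/3
    from the line through the two lattice points, as in the stated triangle. *)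

Lemma wedge_elim z g w y b t A : z * A <= y * b -> g * A <= (w - y) * t ->
  0 <= b -> 0 <= t -> A * (z * t + g * b) <= w * t * b.
Proof. by move=> h1 h2 hb ht; nra. Qed.

(** Here [A] is the overhang to the left of a unit strip of a point at level [y], and the apexes are
    [(b, -z)] and [(t, w + g)]. The bound follows from [wedge_elim] and the identity [e] below; it
    is weaker than the elimination itself but linear in [b] and [t]. *)
Lemma wedge_bound z g w y b t A : 0 <= z -> 0 <= g -> 0 <= y -> y <= w ->
  0 <= b -> 0 <= t -> z * A <= y * b -> g * A <= (w - y) * t ->
  A * (z + g) ^+ 2 <= w * (z * b + g * t).
Proof.
move=> hz hg y0 yw hb ht h1 h2.
have h := wedge_elim _ _ _ _ _ _ _ h1 h2 hb ht.
have [A0|A0] := lerP A 0.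
  have : 0 <= w * (z * b + g * t) by rewrite mulr_ge0 ?addr_ge0 ?mulr_ge0 //; lra.
  by have := sqr_ge0 (z + g); nra.
have [D0|D0] := ltrP 0 (z * t + g * b).
  rewrite -(ler_pM2r D0).
  have e : (z * t + g * b) * (z * b + g * t) =
           t * b * (z + g) ^+ 2 + z * g * (t - b) ^+ 2 by ring.
  have p1 := mulr_ge0 (mulr_ge0 hz hg) (sqr_ge0 (t - b)).
  have w0 : 0 <= w by lra.
  have := ler_wpM2r (sqr_ge0 (z + g)) h.
  have := mulr_ge0 w0 p1.
  by nra.
(* The coefficient of [A] in [wedge_elim] vanishes, so the two hypotheses have to be used
   separately. *)
have zt : z * t = 0 by have := mulr_ge0 hz ht; have := mulr_ge0 hg hb; lra.
have gb : g * b = 0 by have := mulr_ge0 hz ht; have := mulr_ge0 hg hb; lra.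
have g2 := ler_wpM2l hg h2; have z2 := ler_wpM2l hz h1.
have gt := mulr_ge0 hg ht; have zb := mulr_ge0 hz hb.
have [z0|z0] := eqVneq z 0; first by subst z; nra.
have t0 : t = 0 by move/eqP: zt; rewrite mulf_eq0 (negbTE z0) /= => /eqP.
have g0 : g <= 0 by subst t; nra.
have {}g0 : g = 0 by lra.
by subst g t; nra.
Qed.

(** Overhangs on opposite sides see complementary apex positions; adding the two linear bounds
    leaves [w * (z + g)], in which [b] and [t] have cancelled. *)
Lemma wedge_pair z g w y b t A y' B : 0 <= z -> 0 <= g -> 0 < z + g ->
  0 <= y -> y <= w -> 0 <= y' -> y' <= w -> 0 <= b <= 1 -> 0 <= t <= 1 ->
  z * A <= y * b -> g * A <= (w - y) * t ->
  z * B <= y' * (1 - b) -> g * B <= (w - y') * (1 - t) ->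
  (A + B) * (z + g) <= w.
Proof.
move=> hz hg hs y0 yw y0' yw' /andP[b0 b1] /andP[t0 t1] h1 h2 h3 h4.
have e1 := wedge_bound _ _ _ _ _ _ _ hz hg y0 yw b0 t0 h1 h2.
have b1' : 0 <= 1 - b by lra.
have t1' : 0 <= 1 - t by lra.
have e2 := wedge_bound _ _ _ _ _ _ _ hz hg y0' yw' b1' t1' h3 h4.
rewrite -(ler_pM2r hs); nra.
Qed.

(** For two points between the levels of the unit chords; the remaining 1 is the width of the strip.
    With [2 - w < z + g] the claim comes down to [0 <= 2 * (1 - w) ^+ 2]. *)
Lemma frame_inner_le z g w y m A y' B b t : 0 <= z -> 0 <= g -> 0 <= y -> y <= w -> 0 <= y' -> y' <= w ->
  0 <= b <= 1 -> 0 <= t <= 1 -> 0 <= m -> w < 1 -> 2 - w < z + g ->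
  m * g <= 1 - w -> m * z <= 1 - w ->
  z * A <= y * b -> g * A <= (w - y) * t ->
  z * B <= y' * (1 - b) -> g * B <= (w - y') * (1 - t) ->
  A + B + m * (y' - y) <= 1.
Proof.
move=> hz hg y0 yw y0' yw' hb ht m0 w1 hs mg mz h1 h2 h3 h4.
have s0 : 0 < z + g by lra.
have h := wedge_pair _ _ _ _ _ _ _ _ _ hz hg s0 y0 yw y0' yw' hb ht h1 h2 h3 h4.
have mw : m * (y' - y) <= m * w by apply: ler_wpM2l => //; lra.
suff : (A + B + m * w) * (z + g) <= 1 * (z + g) by rewrite ler_pM2r // => ?; lra.
have : m * (z + g) <= 2 * (1 - w) by lra.
nra.
Qed.

(** Compares an overhanging point with a point of the strip at the extreme level [w + g]. A low cap
    allows the apex abscissae to be bounded crudely by 1. *)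
Lemma frame_low_cap_le z g w y m A : 0 <= z -> 0 <= g -> 0 <= y -> y <= w -> 0 <= m <= 1 / 2 ->
  w < 1 -> 2 - w < z + g -> g <= 2 * (1 - w) ->
  z * A <= y -> g * A <= w - y ->
  A - m * y + m * (w + g) <= 1.
Proof.
move=> hz hg y0 yw /andP[m0 m1] w1 hs g2 h1 h2.
have e1 : m * (w + g - y) <= (1/2) * (w + g - y) by apply: ler_wpM2r => //; lra.
have [A0|A0] := lerP A 0; first by nra.
have A1 : A * (2 - w) <= w by nra.
have : (2 - w - g) * A <= y by nra.
move=> hy.
have : (w + g) * (1 + A) <= 2.
  have : (w + g) * (1 + A) <= (2 - w) * (1 + A) by apply: ler_wpM2r; lra.
  by move: A1; lra.
by nra.
Qed.

(** A high cap is pushed sideways by the excluded triangle, which bounds the apex abscissa [t] away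
    from 1; this sharper wedge makes up for the height of the cap. *)
Lemma frame_high_cap_le z g w y m A t : 0 <= z -> 0 <= y -> y <= w -> 0 <= m <= 1 / 2 ->
  w < 1 -> 2 - w < z + g -> 2 * (1 - w) < g -> m * z <= 1 - w ->
  0 <= t <= 1 -> m * g <= (1 - t) * (1 - w) ->
  z * A <= y -> g * A <= (w - y) * t ->
  A - m * y + m <= 1.
Proof.
move=> hz y0 yw /andP[m0 m1] w1 hs g2 mz /andP[t0 t1] mg h1 h2.
have my : 0 <= m * y by rewrite mulr_ge0.
have [A0|A0] := lerP A 0; first by nra.
suff : A + m <= 1 by lra.
have be0 : 0 < 1 - w by lra.
have P0 : 0 <= m * g by rewrite mulr_ge0 //; lra.
have P1 : 0 <= 1 - w - m * g by nra.
(* The bound on [t] enters multiplied by [1 - w], so that [wedge_elim] applies without division. *)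
have h3 : (g * (1 - w)) * A <= (w - y) * (1 - w - m * g).
  have : (w - y) * (t * (1 - w)) <= (w - y) * (1 - w - m * g).
    by apply: ler_wpM2l; nra.
  have := ler_wpM2r (ltW be0) h2.
  by nra.
have h4 : z * A <= y * 1 by rewrite mulr1.
have := wedge_elim _ _ _ _ _ _ _ h4 h3 ler01 P1; rewrite !mulr1 => h.
have D0 : 0 < z * (1 - w - m * g) + g * (1 - w).
  by apply: ltr_wpDl; [rewrite mulr_ge0 | rewrite mulr_gt0 //; lra].
rewrite -(ler_pM2r D0) mul1r mulrDl.
have q1 : 0 <= (1 - w - m * g) * (1 - w - m * z) by rewrite mulr_ge0 //; lra.
have q2 : 0 <= m * g * (g - 2 * (1 - w)) by rewrite mulr_ge0 //; lra.
have q3 : 0 <= (1 - w - m * g) * (z + g - 2 + w) by rewrite mulr_ge0 //; lra.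
apply: le_trans (lerD h (lexx _)) _.
have q4 : 0 <= (1 - w) * (1 - w) by rewrite mulr_ge0 // ltW.
nra.
Qed.
End Algebra.

(** * Bodies with a horizontal unit chord *)

Section RCore.
Variable R : realFieldType.
Implicit Types (k : R -> R -> Prop).

(* Homogeneous weights spare the division in a convex combination. *)
Definition cvx k := forall a b x y x' y' X Y : R, 0 <= a -> 0 <= b -> 0 < a + b ->
  k x y -> k x' y' -> (a + b) * X = a * x + b * x' -> (a + b) * Y = a * y + b * y' -> k X Y.

Lemma cvx_level k x y x' y' Y : cvx k -> k x y -> k x' y' -> y <= Y -> Y <= y' -> y < y' ->
  k (((y' - Y) * x + (Y - y) * x') / (y' - y)) Y.
Proof.
move=> cv h h' h1 h2 h3; apply: (cv (y' - Y) (Y - y) _ _ _ _ _ _ _ _ _ h h').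
- by lra.
- by lra.
- by lra.
- have : y' - y != 0 by rewrite subr_eq0 gt_eqF. 
  by move=> ?; field.
- by ring.
Qed.

Lemma cvx_between k x y x' y' Y : cvx k -> k x y -> k x' y' -> y <= Y <= y' -> y < y' ->
  k (((y' - Y) * x + (Y - y) * x') / (y' - y)) Y.
Proof. by move=> cv h h' /andP[h1 h2]; apply: cvx_level. Qed.

Lemma cvx_hor k x x' X y : cvx k -> k x y -> k x' y -> x <= X -> X <= x' -> k X y.
Proof.
move=> cv h h' h1 h2; have [e|e] := eqVneq x x'.
  by have -> : X = x by lra.
have e' : x < x' by rewrite lt_neqAle e /=; lra.
by apply: (cv (x' - X) (X - x) _ _ _ _ _ _ _ _ _ h h'); lra || ring.
Qed.

(** The homothety centred at [(a, b)] whose ratio is the inverse length of the chord turns it into a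
    unit chord nearer to the level of [(a, b)]. *)
Lemma long_chord k x x' y a b : cvx k -> k x y -> k x' y -> 1 < x' - x -> k a b ->
  exists X th, [/\ 0 < th, th < 1, k X (y + th * (b - y)) & k (X + 1) (y + th * (b - y))].
Proof.
move=> cv h h' hl hab; set l := x' - x in hl.
have ex : x' = x + l by rewrite /l addrC subrK.
have l0 : l != 0 by rewrite gt_eqF //; lra.
have il : l * l^-1 = 1 by rewrite mulfV.
have i0 : 0 < l^-1 by rewrite invr_gt0; lra.
have i1 : l^-1 < 1 by rewrite invf_lt1 //; lra.
clearbody l; subst x'.
move: (l^-1) il i0 i1 => j il i0 i1.
exists (j * x + (1 - j) * a), (1 - j); split.
- lra.
- lra.
- by apply: (cv j (1 - j) _ _ _ _ _ _ _ _ _ h hab); lra || ring.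
- apply: (cv j (1 - j) _ _ _ _ _ _ _ _ _ h' hab); lra.
Qed.

Section Frame.
(* The body is sheared by [x = X + M y], so that the lowest and the highest unit chord become [0,1] at the levels 0 and [w]; its highest and lowest points are [(t, w + xi)] and [(bb, - ze)], and [gapU], [gapD] exclude two unimodular triangles on each unit chord. *)
Variables (k : R -> R -> Prop) (w xi ze t bb M : R).
Hypotheses (cv : cvx k) (k00 : k 0 0) (k10 : k 1 0) (k0w : k 0 w) (k1w : k 1 w).
Hypothesis chord : forall X y, k X y -> k (X + 1) y -> 0 <= y <= w.
Hypotheses (w0 : 0 < w) (M01 : 0 <= M <= 1 / 2).
Hypothesis gapU : forall X y, k X y -> k (X + 1) y -> ~ k (X + (1 - M)) (y + 1).
Hypothesis gapD : forall X y, k X y -> k (X + 1) y -> ~ k (X + M) (y - 1).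
Hypotheses (kT : k t (w + xi)) (top : forall X y, k X y -> y <= w + xi).
Hypotheses (kB : k bb (- ze)) (bot : forall X y, k X y -> - ze <= y).
Hypotheses (tall : 2 < w + xi + ze) (t_flat : xi = 0 -> t = 0) (b_flat : ze = 0 -> bb = 0).

Lemma xi_ge0 : 0 <= xi. Proof. by have := top _ _ k0w; lra. Qed.
Lemma ze_ge0 : 0 <= ze. Proof. by have := bot _ _ k00; lra. Qed.

(** If the section at level [w] left [[0, 1]], it would contain a chord longer than 1, and shrinking
    that towards [(X', y')] would give a unit chord above [w]. *)
Lemma level_w X' y' X : k X' y' -> w < y' -> k X w -> 0 <= X <= 1.
Proof.
have hw := w0.
move=> h' hy h; apply/andP; split; rewrite leNgt; apply/negP => hX.
- have l1 : 1 < 1 - X by lra.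
  have [Z [th [t0 t1 h1 h2]]] := long_chord _ _ _ _ _ _ cv h k1w l1 h'.
  by have /andP[c1 c2] := chord _ _ h1 h2; nra.
- have l1 : 1 < X - 0 by lra.
  have [Z [th [t0 t1 h1 h2]]] := long_chord _ _ _ _ _ _ cv k0w h l1 h'.
  by have /andP[c1 c2] := chord _ _ h1 h2; nra.
Qed.

Lemma level_0 X' y' X : k X' y' -> y' < 0 -> k X 0 -> 0 <= X <= 1.
Proof.
have hw := w0.
move=> h' hy h; apply/andP; split; rewrite leNgt; apply/negP => hX.
- have l1 : 1 < 1 - X by lra.
  have [Z [th [t0 t1 h1 h2]]] := long_chord _ _ _ _ _ _ cv h k10 l1 h'.
  by have /andP[c1 c2] := chord _ _ h1 h2; nra.
- have l1 : 1 < X - 0 by lra.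
  have [Z [th [t0 t1 h1 h2]]] := long_chord _ _ _ _ _ _ cv k00 h l1 h'.
  by have /andP[c1 c2] := chord _ _ h1 h2; nra.
Qed.

(** The segments down to [(0, 0)] and [(1, 0)] cross level [w] within [[0, 1]]; the first fixes the
    sign of [X], the second that of [X - 1]. *)
Lemma outer_above X y : k X y -> w < y -> 0 <= X <= 1.
Proof.
have hw := w0.
move=> h hy.
have a1 := cvx_between _ _ _ _ _ w cv k00 h ltac:(idtac; apply/andP; split; lra) ltac:(idtac; lra).
have a2 := cvx_between _ _ _ _ _ w cv k10 h ltac:(idtac; apply/andP; split; lra) ltac:(idtac; lra).
have y0 : 0 < y - 0 by lra.
have /andP[b1 _] := level_w _ _ _ h hy a1.
have /andP[_ b2] := level_w _ _ _ h hy a2.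
move: b1 b2; rewrite ler_pdivlMr // ler_pdivrMr // => b1 b2.
by apply/andP; split; nra.
Qed.

Lemma outer_below X y : k X y -> y < 0 -> 0 <= X <= 1.
Proof.
have hw := w0.
move=> h hy.
have a1 := cvx_between _ _ _ _ _ 0 cv h k0w ltac:(idtac; apply/andP; split; lra) ltac:(idtac; lra).
have a2 := cvx_between _ _ _ _ _ 0 cv h k1w ltac:(idtac; apply/andP; split; lra) ltac:(idtac; lra).
have y0 : 0 < w - y by lra.
have /andP[b1 _] := level_0 _ _ _ h hy a1.
have /andP[_ b2] := level_0 _ _ _ h hy a2.
move: b1 b2; rewrite ler_pdivlMr // ler_pdivrMr // => b1 b2.
by apply/andP; split; nra.
Qed.

Lemma t01 : 0 <= t <= 1.
Proof.
have hw := w0.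
have [e|e] := eqVneq xi 0; first by rewrite t_flat // lexx ler01.
by apply: outer_above kT _; rewrite ltrDl lt_neqAle eq_sym e xi_ge0.
Qed.

Lemma b01 : 0 <= bb <= 1.
Proof.
have hw := w0.
have [e|e] := eqVneq ze 0; first by rewrite b_flat // lexx ler01.
by apply: outer_below kB _; rewrite oppr_lt0 lt_neqAle eq_sym e ze_ge0.
Qed.

(** The segment to the highest point crosses level [w] within [[0, 1]]. For [xi = 0] there is no
    segment, and both claims only say that the right sides are nonnegative. *)
Lemma wedge_above X y : k X y -> 0 <= y <= w ->
  xi * - X <= (w - y) * t /\ xi * (X - 1) <= (w - y) * (1 - t).
Proof.
have hw := w0.
move=> h /andP[y0 yw]; have /andP[t0 t1] := t01.
have [e|e] := eqVneq xi 0.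
  by rewrite e !mul0r; split; rewrite mulr_ge0 //; lra.
have xi0 : 0 < xi by rewrite lt_neqAle eq_sym e xi_ge0.
have a := cvx_between _ _ _ _ _ w cv h kT ltac:(idtac; apply/andP; split; lra) ltac:(idtac; lra).
have /andP[] := level_w _ _ _ kT ltac:(lra) a.
have p0 : 0 < w + xi - y by lra.
by rewrite ler_pdivlMr // ler_pdivrMr // => a1 a2; split; nra.
Qed.

Lemma wedge_below X y : k X y -> 0 <= y <= w ->
  ze * - X <= y * bb /\ ze * (X - 1) <= y * (1 - bb).
Proof.
have hw := w0.
move=> h /andP[y0 yw]; have /andP[t0 t1] := b01.
have [e|e] := eqVneq ze 0.
  by rewrite e !mul0r; split; rewrite mulr_ge0 //; lra.
have ze0 : 0 < ze by rewrite lt_neqAle eq_sym e ze_ge0.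
have a := cvx_between _ _ _ _ _ 0 cv kB h ltac:(idtac; apply/andP; split; lra) ltac:(idtac; lra).
have /andP[] := level_0 _ _ _ kB ltac:(lra) a.
have p0 : 0 < y - - ze by lra.
by rewrite ler_pdivlMr // ler_pdivrMr // => a1 a2; split; nra.
Qed.

(** Otherwise the parallelogram spanned by the two unit chords contains [(1 - M, 1)], which
    completes a unimodular triangle on the lower chord. *)
Lemma w_lt1 : w < 1.
Proof.
have hw := w0.
case/andP: M01 => M0 M1; rewrite ltNge; apply/negP => w1.
apply: (gapU _ _ k00); rewrite ?add0r //.
have a := cvx_between _ _ _ _ _ 1 cv k00 k0w ltac:(idtac; apply/andP; split; lra) ltac:(idtac; lra).
have b := cvx_between _ _ _ _ _ 1 cv k10 k1w ltac:(idtac; apply/andP; split; lra) ltac:(idtac; lra).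
have w' : w - 0 != 0 by rewrite subr0 gt_eqF.
apply: (cvx_hor _ _ _ _ _ cv a b).
  by rewrite !mulr0 addr0 mul0r; lra.
have -> : (w - 1) * 1 + (1 - 0) * 1 = w - 0 by ring.
by rewrite divff //; lra.
Qed.

(** The section at level 1 is an interval that misses [1 - M] by [gapU]. *)
Lemma upper_side : (forall X, k X 1 -> X < 1 - M) \/ (forall X, k X 1 -> 1 - M < X).
Proof.
have hw := w0.
have n1 : ~ k (1 - M) 1.
  by move=> h; apply: (gapU _ _ k00); rewrite ?add0r.
have [[X hX X1]|h] := pselect (exists2 X, k X 1 & 1 - M < X); last first.
  left=> X hX; rewrite lt_neqAle; apply/andP; split.
    by apply/eqP => e; apply: n1; rewrite -e.
  by rewrite leNgt; apply/negP => hl; apply: h; exists X.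
right=> Y hY; rewrite ltNge; apply/negP => hl; apply: n1.
exact: (cvx_hor _ _ _ _ _ cv hY hX hl (ltW X1)).
Qed.

Lemma lower_side : (forall X, k X (w - 1) -> X < M) \/ (forall X, k X (w - 1) -> M < X).
Proof.
have hw := w0.
have n1 : ~ k M (w - 1).
  by move=> h; apply: (gapD _ _ k0w); rewrite ?add0r.
have [[X hX X1]|h] := pselect (exists2 X, k X (w - 1) & M < X); last first.
  left=> X hX; rewrite lt_neqAle; apply/andP; split.
    by apply/eqP => e; apply: n1; rewrite -e.
  by rewrite leNgt; apply/negP => hl; apply: h; exists X.
right=> Y hY; rewrite ltNge; apply/negP => hl; apply: n1.
exact: (cvx_hor _ _ _ _ _ cv hY hX hl (ltW X1)).
Qed.

(** If the section at level 1 lies to the right of [1 - M], the segment from [(0, w)] to the highest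
    point must move right by more than [1 - M >= 1 / 2] before level 1, so that point is low. If it
    lies to the left, the segments from [(1, w)] to points beyond level 1 are trimmed. *)
Lemma upper_cases : xi <= 2 * (1 - w) \/
  forall X y, k X y -> 1 <= y -> M * (y - w) <= (1 - X) * (1 - w).
Proof.
have hw := w0.
have w1 := w_lt1; case/andP: M01 => M0 M1.
have [hlo|hhi] := upper_side.
  right=> X y h y1.
  have a := hlo _ (cvx_between _ _ _ _ _ 1 cv k1w h ltac:(idtac; apply/andP; split; lra) ltac:(idtac; lra)).
  have p0 : 0 < y - w by lra.
  by move: a; rewrite ltr_pdivrMr // => a; nra.
left; rewrite leNgt; apply/negP => hxi.
have a := hhi _ (cvx_between _ _ _ _ _ 1 cv k0w kT ltac:(idtac; apply/andP; split; lra) ltac:(idtac; lra)).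
have p0 : 0 < w + xi - w by lra.
have /andP[t0 t1] := t01.
by move: a; rewrite ltr_pdivlMr // => a; nra.
Qed.

Lemma lower_cases : ze <= 2 * (1 - w) \/
  forall X y, k X y -> y <= w - 1 -> M * (- y) <= X * (1 - w).
Proof.
have hw := w0.
have w1 := w_lt1; case/andP: M01 => M0 M1.
have [hlo|hhi] := lower_side; last first.
  right=> X y h y1.
  have a := hhi _ (cvx_between _ _ _ _ _ (w - 1) cv h k00 ltac:(idtac; apply/andP; split; lra) ltac:(idtac; lra)).
  have p0 : 0 < 0 - y by lra.
  by move: a; rewrite ltr_pdivlMr // => a; nra.
left; rewrite leNgt; apply/negP => hxi.
have a := hlo _ (cvx_between _ _ _ _ _ (w - 1) cv kB k10 ltac:(idtac; apply/andP; split; lra) ltac:(idtac; lra)).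
have p0 : 0 < 0 - - ze by lra.
have /andP[t0 t1] := b01.
by move: a; rewrite ltr_pdivrMr // => a; nra.
Qed.

Lemma M_xi : M * xi <= 1 - w.
Proof.
have w1 := w_lt1; case/andP: M01 => M0 M1; case/andP: t01 => t0 t1; have x0 := xi_ge0.
have [h|h] := lerP xi (2 * (1 - w)); first by nra.
have [|/(_ _ _ kT)] := upper_cases; first by lra.
by move=> /(_ ltac:(idtac; lra)); nra.
Qed.

Lemma M_ze : M * ze <= 1 - w.
Proof.
have w1 := w_lt1; case/andP: M01 => M0 M1; case/andP: b01 => t0 t1; have x0 := ze_ge0.
have [h|h] := lerP ze (2 * (1 - w)); first by nra.
have [|/(_ _ _ kB)] := lower_cases; first by lra.
by move=> /(_ ltac:(idtac; lra)); nra.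
Qed.

Lemma outer_inner_le X y X' y' : k X y -> (y < 0) || (w < y) -> k X' y' -> 0 <= y' <= w ->
  (X + M * y) - (X' + M * y') <= 2.
Proof.
move=> h hy h' hy'; have hw := w0; have ht := tall.
have w1 := w_lt1; case/andP: (M01) => M0 M1; case/andP: t01 => t0 t1; have x0 := xi_ge0.
case/andP: b01 => b0 b1; have z0 := ze_ge0.
have [a1 a2] := wedge_above _ _ h' hy'; have [a3 a4] := wedge_below _ _ h' hy'.
case/andP: (hy') => y0 yw.
have X1 : X <= 1 by case/orP: hy => hy; [have /andP[] := outer_below _ _ h hy | have /andP[] := outer_above _ _ h hy].
have mx := M_xi; have mz := M_ze; have htop := top _ _ h.
have a5 : ze * - X' <= y' by nra.
have [g2|g2] := lerP xi (2 * (1 - w)).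
  have a6 : xi * - X' <= w - y' by nra.
  have hs : 2 - w < ze + xi by lra.
  have := frame_low_cap_le _ _ _ _ _ _ _ z0 x0 y0 yw M01 w1 hs g2 a5 a6.
  by case/orP: hy => hy; nra.
have hs : 2 - w < ze + xi by lra.
have [|hu] := upper_cases; first by lra.
have a6 : M * xi <= (1 - t) * (1 - w).
  by have := hu _ _ kT ltac:(idtac; lra); lra.
have := frame_high_cap_le _ _ _ _ _ _ _ _ z0 y0 yw M01 w1 hs g2 mz t01 a6 a5 a1.
(* The trimming [hu] concerns only levels from 1 upwards; below level 1 the shear contributes at
   most [M]. *)
have [y1|y1] := lerP 1 y; last first.
  have : M * y <= M * 1 by apply: ler_wpM2l => //; lra.
  by lra.
have := hu _ _ h y1.
have : M * (y - w) * (1 - w) <= M * (y - w) * 1.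
  by apply: ler_wpM2l; [rewrite mulr_ge0 //; lra | lra].
have : M * w <= M * 1 by apply: ler_wpM2l => //; lra.
have : (1 - X) * (1 - w) <= (1 - X) * 1 by apply: ler_wpM2l; lra.
by lra.
Qed.

Lemma inner_outer_le X y X' y' : k X y -> 0 <= y <= w -> k X' y' -> (y' < 0) || (w < y') ->
  (X + M * y) - (X' + M * y') <= 2.
Proof.
move=> h' hy' h hy; have hw := w0; have ht := tall.
have w1 := w_lt1; case/andP: (M01) => M0 M1; case/andP: t01 => t0 t1; have x0 := xi_ge0.
case/andP: b01 => b0 b1; have z0 := ze_ge0.
have [a1 a2] := wedge_above _ _ h' hy'; have [a3 a4] := wedge_below _ _ h' hy'.
case/andP: (hy') => y0 yw.
have X1 : 0 <= X' by case/orP: hy => hy; [have /andP[] := outer_below _ _ h hy | have /andP[] := outer_above _ _ h hy].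
have mx := M_xi; have mz := M_ze; have hbot := bot _ _ h.
have y0' : 0 <= w - y by lra. have yw' : w - y <= w by lra.
have a5 : xi * (X - 1) <= w - y by nra.
have hs : 2 - w < xi + ze by lra.
have [g2|g2] := lerP ze (2 * (1 - w)).
  have a6 : ze * (X - 1) <= w - (w - y) by nra.
  have := frame_low_cap_le _ _ _ _ _ _ _ x0 z0 y0' yw' M01 w1 hs g2 a5 a6.
  by case/orP: hy => hy; nra.
have [|hu] := lower_cases; first by lra.
have a6 : M * ze <= (1 - (1 - bb)) * (1 - w).
  by have := hu _ _ kB ltac:(idtac; lra); lra.
have b01' : 0 <= 1 - bb <= 1 by apply/andP; split; lra.
have a7 : ze * (X - 1) <= (w - (w - y)) * (1 - bb) by rewrite subKr.
have := frame_high_cap_le _ _ _ _ _ _ _ _ x0 y0' yw' M01 w1 hs g2 mx b01' a6 a5 a7.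
have [y1|y1] := lerP y' (w - 1); last first.
  have : M * - y' <= M * (1 - w) by apply: ler_wpM2l => //; lra.
  by lra.
have := hu _ _ h y1.
have : 0 <= M * (1 - w) by rewrite mulr_ge0 //; lra.
have : X' * (1 - w) <= X' * 1 by apply: ler_wpM2l; lra.
by lra.
Qed.

(** The bound is 2 unless both points lie outside the levels [[0, w]]; in that case the abscissae
    differ by at most 1 and the shear adds at most half the height. *)
Lemma frame_width X y X' y' : k X y -> k X' y' ->
  (X + M * y) - (X' + M * y') <= 1 + (w + xi + ze) / 2.
Proof.
move=> h h'; have hw := w0; have ht := tall.
have w1 := w_lt1; case/andP: (M01) => M0 M1; case/andP: t01 => t0 t1; have x0 := xi_ge0.
case/andP: b01 => b0 b1; have z0 := ze_ge0.
have [hy|] := boolP (0 <= y <= w); have [hy'|] := boolP (0 <= y' <= w).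
- case/andP: (hy) => y0 yw; case/andP: (hy') => y0' yw'.
  have [a1 a2] := wedge_above _ _ h hy; have [a3 a4] := wedge_below _ _ h hy.
  have [c1 c2] := wedge_above _ _ h' hy'; have [c3 c4] := wedge_below _ _ h' hy'.
  have hs : 2 - w < ze + xi by lra.
  have := frame_inner_le _ _ _ _ _ _ _ _ _ _ _ z0 x0 y0' yw' y0 yw b01 t01 M0 w1 hs M_xi M_ze c3 c1 a4 a2.
  by lra.
- rewrite negb_and -!ltNge => hy'.
  by have := inner_outer_le _ _ _ _ h hy h' hy'; lra.
- rewrite negb_and -!ltNge => hy.
  by have := outer_inner_le _ _ _ _ h hy h' hy'; lra.
- rewrite !negb_and -!ltNge => hy' hy.
  have htop := top _ _ h; have hbot := bot _ _ h'.
  have X1 : X <= 1 by case/orP: hy => hy; [have /andP[] := outer_below _ _ h hy | have /andP[] := outer_above _ _ h hy].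
  have X0 : 0 <= X' by case/orP: hy' => hy'; [have /andP[] := outer_below _ _ h' hy' | have /andP[] := outer_above _ _ h' hy'].
  have : M * (y - y') <= M * (w + xi + ze) by apply: ler_wpM2l => //; lra.
  have : M * (w + xi + ze) <= 1 / 2 * (w + xi + ze) by apply: ler_wpM2r => //; lra.
  by lra.
Qed.

End Frame.
End RCore.

(** * Unimodular changes of coordinates *)

Section Planar.
Variable R : realType.
Implicit Types (k : R -> R -> Prop) (p q r s : int).

(* The body [k] in the coordinates [X], [Y] with [x = p X + q Y + e], [y = r X + s Y + f]. *)
Definition tr p q r s (e f : R) k : R -> R -> Prop :=
  fun X Y => k (p%:~R * X + q%:~R * Y + e) (r%:~R * X + s%:~R * Y + f).

Definition unimodular p q r s := p * s - q * r = 1 \/ p * s - q * r = -1.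

Definition attains k := forall c d : R, (exists x y, k x y) ->
  exists x y, k x y /\ forall x' y', k x' y' -> c * x' + d * y' <= c * x + d * y.

(* Compactness enters only through attained maxima; shifting by [(1,0)] gives the extreme levels of horizontal unit chords. *)
Definition body k := cvx R k /\
  forall u v : R, attains (fun x y => k x y /\ k (x + u) (y + v)).

(** A one-sided inequality suffices because the two points may be exchanged. *)
Definition narrow k (c : R) := exists u v : int, ~ (u = 0 /\ v = 0) /\
  forall x y x' y', k x y -> k x' y' -> u%:~R * (x - x') + v%:~R * (y - y') <= c.

(** Only the vertices are recorded; convexity supplies the rest of the triangle. *)
Definition triangle_free k := forall (x y : R) p q r s, unimodular p q r s ->
  k x y -> k (x + p%:~R) (y + r%:~R) -> k (x + q%:~R) (y + s%:~R) -> False.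

Lemma attains_ext k k' : (forall x y, k x y <-> k' x y) -> attains k -> attains k'.
Proof.
move=> e h c d [x [y hxy]].
have [|X [Y [h1 h2]]] := h c d; first by exists x, y; apply/e.
by exists X, Y; split; [exact/e | move=> x' y' /e; exact: h2].
Qed.

Lemma body_attains k : body k -> attains k.
Proof.
move=> [_ /(_ 0 0)]; apply: attains_ext => x y; rewrite !addr0; tauto.
Qed.

Lemma unimodularR p q r s : unimodular p q r s ->
  exists2 D : int, D * D = 1 & D = p * s - q * r.
Proof. by move=> u; exists (p * s - q * r) => //; case: u => ->. Qed.

(** The determinant [D] is 1 or -1, hence its own inverse, and the inverse matrix is [D] times the
    adjugate. *)
Lemma tr_inv p q r s e f k x y : unimodular p q r s -> k x y ->
  let D : R := p%:~R * s%:~R - q%:~R * r%:~R in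
  tr p q r s e f k (D * (s%:~R * (x - e) - q%:~R * (y - f)))
                   (D * (p%:~R * (y - f) - r%:~R * (x - e))).
Proof.
move=> u h D; rewrite /tr.
have D2 : D * D = 1.
  have [D' h1 h2] := unimodularR _ _ _ _ u.
  have -> : D = D'%:~R by rewrite h2 /D !intrD !rmorphN !rmorphM.
  by rewrite -intrM h1.
have -> : p%:~R * (D * (s%:~R * (x - e) - q%:~R * (y - f))) +
          q%:~R * (D * (p%:~R * (y - f) - r%:~R * (x - e))) + e =
          (D * D) * (x - e) + e by rewrite /D; ring.
have -> : r%:~R * (D * (s%:~R * (x - e) - q%:~R * (y - f))) +
          s%:~R * (D * (p%:~R * (y - f) - r%:~R * (x - e))) + f =
          (D * D) * (y - f) + f by rewrite /D; ring.
by rewrite D2 !mul1r !subrK.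
Qed.

Lemma tr_cvx p q r s e f k : cvx R k -> cvx R (tr p q r s e f k).
Proof.
move=> cv a b x y x' y' X Y a0 b0 ab h h' eX eY.
apply: (cv _ _ _ _ _ _ _ _ a0 b0 ab h h').
  rewrite mulrDr [in LHS]mulrDr !(mulrCA (a + b)) eX eY; ring.
by rewrite mulrDr [in LHS]mulrDr !(mulrCA (a + b)) eX eY; ring.
Qed.

Lemma tr_attains p q r s e f k : unimodular p q r s -> attains k -> attains (tr p q r s e f k).
Proof.
move=> u h c d [X0 [Y0 h0]].
have [D' D1 D2] := unimodularR _ _ _ _ u.
set D : R := p%:~R * s%:~R - q%:~R * r%:~R.
have DD : D * D = 1.
  have -> : D = D'%:~R by rewrite D2 /D !intrD !rmorphN !rmorphM.
  by rewrite -intrM D1.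
have [|x [y [hxy mx]]] := h (D * (c * s%:~R - d * r%:~R)) (D * (d * p%:~R - c * q%:~R)).
  by eexists; eexists; exact: h0.
have := tr_inv _ _ _ _ e f _ _ _ u hxy; rewrite -/D /= => h1.
eexists; eexists; split; first exact: h1.
move=> X Y hXY; have := mx _ _ hXY.
have E a b : D * (c * s%:~R - d * r%:~R) * a + D * (d * p%:~R - c * q%:~R) * b =
  c * (D * (s%:~R * (a - e) - q%:~R * (b - f))) + d * (D * (p%:~R * (b - f) - r%:~R * (a - e)))
  + (D * (c * s%:~R - d * r%:~R) * e + D * (d * p%:~R - c * q%:~R) * f) by ring.
rewrite [leLHS]E [leRHS]E lerD2r.
have -> : D * (s%:~R * (p%:~R * X + q%:~R * Y + e - e) - q%:~R * (r%:~R * X + s%:~R * Y + f - f)) = (D * D) * X.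
  by rewrite /D; ring.
have -> : D * (p%:~R * (r%:~R * X + s%:~R * Y + f - f) - r%:~R * (p%:~R * X + q%:~R * Y + e - e)) = (D * D) * Y.
  by rewrite /D; ring.
by rewrite DD !mul1r.
Qed.

Lemma tr_body p q r s e f k : unimodular p q r s -> body k -> body (tr p q r s e f k).
Proof.
move=> u [cv h]; split; first exact: tr_cvx.
move=> a b; have := tr_attains _ _ _ _ e f _ u (h (p%:~R * a + q%:~R * b) (r%:~R * a + s%:~R * b)).
apply: attains_ext => x y; rewrite /tr.
have -> : p%:~R * x + q%:~R * y + e + (p%:~R * a + q%:~R * b) = p%:~R * (x + a) + q%:~R * (y + b) + e by ring.
by have -> : r%:~R * x + s%:~R * y + f + (r%:~R * a + s%:~R * b) = r%:~R * (x + a) + s%:~R * (y + b) + f by ring.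
Qed.

(** Directions are pulled back by the inverse transpose, which is integral and injective. *)
Lemma tr_narrow p q r s e f k c : unimodular p q r s -> narrow (tr p q r s e f k) c -> narrow k c.
Proof.
move=> un [u [v [nz h]]].
have [D D1 D2] := unimodularR _ _ _ _ un.
exists (D * (u * s - v * r)), (D * (v * p - u * q)); split.
  move=> [e1 e2]; apply: nz.
  have f1 : u * s - v * r = 0 by rewrite -[LHS]mul1r -D1 -mulrA e1 mulr0.
  have f2 : v * p - u * q = 0 by rewrite -[LHS]mul1r -D1 -mulrA e2 mulr0.
  have g1 : D * u = (u * s - v * r) * p + (v * p - u * q) * r by rewrite D2; ring.
  have g2 : D * v = (v * p - u * q) * s + (u * s - v * r) * q by rewrite D2; ring.
  rewrite f1 f2 !mul0r addr0 in g1; rewrite f1 f2 !mul0r addr0 in g2.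
  by split; rewrite -[LHS]mul1r -D1 -mulrA (g1, g2) mulr0.
move=> x y x' y' hk hk'.
have := h _ _ _ _ (tr_inv _ _ _ _ e f _ _ _ un hk) (tr_inv _ _ _ _ e f _ _ _ un hk').
have -> : p%:~R * s%:~R - q%:~R * r%:~R = D%:~R :> R.
  by rewrite D2 intrD rmorphN !rmorphM.
rewrite !intrM !intrD !rmorphN !rmorphM.
suff -> : D%:~R * (u%:~R * s%:~R - v%:~R * r%:~R) * (x - x') +
   D%:~R * (v%:~R * p%:~R - u%:~R * q%:~R) * (y - y') =
   u%:~R * (D%:~R * (s%:~R * (x - e) - q%:~R * (y - f)) -
      D%:~R * (s%:~R * (x' - e) - q%:~R * (y' - f))) +
   v%:~R * (D%:~R * (p%:~R * (y - f) - r%:~R * (x - e)) -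
      D%:~R * (p%:~R * (y' - f) - r%:~R * (x' - e))) by [].
by ring.
Qed.
End Planar.

(** * Halving the excess of the width over 2 *)

Section RRow.
Variable R : realType.
Implicit Types (k : R -> R -> Prop) (p q r s : int).

Lemma unimodular_mul p q r s p' q' r' s' : unimodular p q r s -> unimodular p' q' r' s' ->
  unimodular (p * p' + q * r') (p * q' + q * s') (r * p' + s * r') (r * q' + s * s').
Proof.
move=> h h'; rewrite /unimodular.
have -> : (p * p' + q * r') * (r * q' + s * s') - (p * q' + q * s') * (r * p' + s * r') =
  (p * s - q * r) * (p' * s' - q' * r') by ring.
by case: h => ->; case: h' => ->; rewrite ?mulr1 ?mulN1r ?opprK; tauto.
Qed.

Lemma tr_triangle_free p q r s e f k : unimodular p q r s ->
  triangle_free R k -> triangle_free R (tr R p q r s e f k).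
Proof.
move=> u h x y p' q' r' s' u'; rewrite /tr => h1 h2 h3.
apply: (h _ _ _ _ _ _ (unimodular_mul _ _ _ _ _ _ _ _ u u') h1).
  move: h2; rewrite !intrD !intrM; congr (k _ _); ring.
by move: h3; rewrite !intrD !intrM; congr (k _ _); ring.
Qed.

Lemma nearest_int (M : R) : exists j : int, - (1 / 2) <= M - j%:~R <= 1 / 2.
Proof.
exists (Num.floor (M + 1 / 2)); have /andP[h1 h2] := floor_itv (M + 1/2).
by move: h2; rewrite intrD => h2; apply/andP; split; lra.
Qed.

(* Two pairs of points with opposite height differences average to a pair at equal height, which bounds one slope by the other. *)
Lemma slab k : cvx R k -> (forall x x' y, k x y -> k x' y -> x' - x <= 1) ->
  (exists x y x' y', [/\ k x y, k x' y' & y' < y]) ->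
  exists M, forall x y x' y', k x y -> k x' y' -> (x - x') - M * (y - y') <= 1.
Proof.
move=> cv ch [ax [ay [bx [by_ [ha hb hab]]]]].
pose E : set R := fun z => exists x y x' y',
  [/\ k x y, k x' y', y' < y & z = (x - x' - 1) / (y - y')].
have ub x y x' y' : k x y -> k x' y' -> y' < y -> ubound E ((x - x' + 1) / (y - y')).
  move=> h h' hy _ [X [Y [X' [Y' [H H' HY ->]]]]].
  have d0 : 0 < y - y' by lra.
  have D0 : 0 < Y - Y' by lra.
  have e0 : (y - y') + (Y - Y') != 0 by rewrite gt_eqF //; lra.
  rewrite ler_pdivrMr // mulrAC ler_pdivlMr //.
  have c1 : k (((y - y') * X' + (Y - Y') * x) / ((y - y') + (Y - Y')))
      (((y - y') * Y' + (Y - Y') * y) / ((y - y') + (Y - Y'))).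
    by apply: (cv (y - y') (Y - Y') _ _ _ _ _ _ _ _ _ H' h); rewrite 1?[LHS]mulrC ?divfK //; lra.
  have c2 : k (((y - y') * X + (Y - Y') * x') / ((y - y') + (Y - Y')))
      (((y - y') * Y' + (Y - Y') * y) / ((y - y') + (Y - Y'))).
    by apply: (cv (y - y') (Y - Y') _ _ _ _ _ _ _ _ _ H h'); rewrite 1?[LHS]mulrC ?divfK //; lra.
  have := ch _ _ _ c1 c2.
  by rewrite -mulrBl ler_pdivrMr; lra.
have Es : has_sup E.
  split; first by exists ((ax - bx - 1) / (ay - by_)), ax, ay, bx, by_.
  by exists ((ax - bx + 1) / (ay - by_)); exact: ub.
exists (sup E) => x y x' y' h h'.
have [hy|hy|e] := ltgtP y' y.
- have d0 : 0 < y - y' by lra.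
  have : (x - x' - 1) / (y - y') <= sup E by apply: ub_le_sup; [exact: Es.2|exists x, y, x', y'].
  by rewrite ler_pdivrMr //; lra.
- have d0 : 0 < y' - y by lra.
  have : sup E <= (x' - x + 1) / (y' - y) by apply: ge_sup; [exact: Es.1|exact: ub].
  by rewrite ler_pdivlMr //; lra.
- by subst y'; have := ch _ _ _ h' h; lra.
Qed.

Lemma frame_row k w M h : body R k -> triangle_free R k ->
  k 0 0 -> k 1 0 -> k (M * w) w -> k (M * w + 1) w ->
  (forall X y, k X y -> k (X + 1) y -> 0 <= y <= w) -> 0 < w -> 0 <= M <= 1 / 2 ->
  (forall x y x' y', k x y -> k x' y' -> y - y' <= h) ->
  (exists x y x' y', [/\ k x y, k x' y' & 2 < y - y']) ->
  forall x y x' y', k x y -> k x' y' -> x - x' <= 1 + h / 2.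
Proof.
move=> bk tf k00 k10 k0w k1w ch w0 M01 hh [x1 [y1 [x2 [y2 [h1 h2 h12]]]]].
have at_ := body_attains _ _ bk; case: bk => cv _.
have [|xT [yT [kT topT]]] := at_ 0 1; first by exists 0, 0.
have [|xB [yB [kB botB]]] := at_ 0 (-1); first by exists 0, 0.
have {}topT x y : k x y -> y <= yT by move/topT; lra.
have {}botB x y : k x y -> yB <= y by move/botB; lra.
pose kk X y := k (X + M * y) y.
have cvk : cvx R kk.
  move=> a b x y x' y' X Y a0 b0 ab hx hx' eX eY.
  apply: (cv _ _ _ _ _ _ _ _ a0 b0 ab hx hx' _ eY).
  by rewrite mulrDr eX mulrCA eY; ring.
(* When the body stops at level [w], the highest point need not be unique; the end [(0, w)] of the
   chord is chosen, as [t_flat] demands. *)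
have [t [ht ht0]] : exists t, kk t (w + (yT - w)) /\ (yT - w = 0 -> t = 0).
  have [e|ne] := eqVneq (yT - w) 0.
    exists 0; split => //; rewrite e /kk addr0 add0r //.
  exists (xT - M * yT); split=> [|/eqP]; last by rewrite (negbTE ne).
  have -> : w + (yT - w) = yT by ring.
  by rewrite /kk subrK.
have [b [hb hb0]] : exists t, kk t (- - yB) /\ (- yB = 0 -> t = 0).
  have [e|ne] := eqVneq (- yB) 0.
    by exists 0; split => //; rewrite e /kk oppr0 mulr0 add0r.
  exists (xB - M * yB); split=> [|/eqP]; last by rewrite (negbTE ne).
  by rewrite /kk opprK subrK.
move=> x y x' y' hx hx'.
have toKK X Y : k X Y -> kk (X - M * Y) Y by rewrite /kk subrK.
have e1 X Y : X + 1 + M * Y = X + M * Y + 1 by ring.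
suff : (x - M * y + M * y) - (x' - M * y' + M * y') <= 1 + (w + (yT - w) + - yB) / 2.
  by have := hh _ _ _ _ kT kB; lra.
apply: (frame_width R kk w (yT - w) (- yB) t b M cvk _ _ _ _ _ w0 M01 _ _ ht _ hb _ _ ht0 hb0
  _ _ _ _ (toKK _ _ hx) (toKK _ _ hx')).
- by rewrite /kk mulr0 addr0.
- by rewrite /kk mulr0 addr0.
- by rewrite /kk add0r.
- by rewrite /kk addrC.
- by move=> X Y; rewrite /kk e1; exact: ch.
(* Without the shear, the third vertex is the left end of the chord plus [(1, 1)]; in the next item
   it is the left end plus [(0, -1)]. *)
- move=> X Y; rewrite /kk e1 => H1 H2 H3.
  apply: (tf _ _ 1 1 0 1 _ H1); rewrite ?addr0 //; first by left.
  by move: H3; congr (k _ _); ring.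
- move=> X Y; rewrite /kk e1 => H1 H2 H3.
  apply: (tf _ _ 1 0 0 (-1) _ H1); rewrite ?addr0 //; first by right.
  by move: H3; congr (k _ _); rewrite ?rmorphN1; ring.
- by move=> X Y /topT; lra.
- by move=> X Y /botB; lra.
- by have := topT _ _ h1; have := botB _ _ h2; lra.
Qed.

Lemma row_step k h : body R k -> triangle_free R k -> 2 <= h ->
  (forall x y x' y', k x y -> k x' y' -> y - y' <= h) -> narrow R k (1 + h / 2).
Proof.
move=> bk tf h2 hh; have at_ := body_attains _ _ bk; have [cv ach] := bk.
have [[x0 [y0 hxy]]|emp] := pselect (exists x y, k x y); last first.
  exists 1, 0; split; first by case.
  by move=> x y x' y' hx; case: emp; exists x, y.
have [|xT [yT [kT topT]]] := at_ 0 1; first by exists x0, y0.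
have [|xB [yB [kB botB]]] := at_ 0 (-1); first by exists x0, y0.
have {}topT x y : k x y -> y <= yT by move/topT; lra.
have {}botB x y : k x y -> yB <= y by move/botB; lra.
have [small|tall] := lerP (yT - yB) 2.
  exists 0, 1; split; first by case.
  by move=> x y x' y' /topT hT /botB hB; lra.
have [[x [x' [y [h1 h1' hc]]]]|nch] := pselect (exists x x' y, [/\ k x y, k x' y & 1 < x' - x]); last first.
  have [||M hM] := slab k cv.
  - move=> x x' y h1 h1'; rewrite leNgt; apply/negP => hc; apply: nch; by exists x, x', y.
  - by exists xT, yT, xB, yB; split => //; lra.
  (* Rounding the slope of the strip to an integer costs at most 1/2 per unit of height. *)
  have [j /andP[j1 j2]] := nearest_int M.
  exists 1, (- j); split; first by case.
  move=> x y x' y' hx hx'; have := hM _ _ _ _ hx hx'.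
  have d1 := hh _ _ _ _ hx hx'; have d2 := hh _ _ _ _ hx' hx.
  rewrite rmorphN /=; move: (j%:~R) j1 j2 => J j1 j2.
  by have [e|e] := lerP 0 (y - y'); nra.
have hx1 : k (x + 1) y by apply: (cvx_hor _ _ _ _ _ _ cv h1 h1'); lra.
have [|x1 [w1 [[u1 u1'] top1]]] := ach 1 0 0 1; first by exists x, y; rewrite addr0.
have [|xx0 [w0 [[v1 v1'] bot1]]] := ach 1 0 0 (-1); first by exists x, y; rewrite addr0.
rewrite addr0 in u1'; rewrite addr0 in v1'.
have {}top1 X Y : k X Y -> k (X + 1) Y -> Y <= w1.
  by move=> a b; have := top1 X Y; rewrite addr0 => /(_ (conj a b)); lra.
have {}bot1 X Y : k X Y -> k (X + 1) Y -> w0 <= Y.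
  by move=> a b; have := bot1 X Y; rewrite addr0 => /(_ (conj a b)); lra.
(* A chord longer than 1 shrinks to a unit chord towards the top, or towards the bottom if it is
   itself at the top; this gives a unit chord at another level. *)
have w01 : w0 < w1.
  have t1 := top1 _ _ h1 hx1; have b1 := bot1 _ _ h1 hx1.
  have [e|e] := ltrP y yT.
    have [X [th [t0 t1' H1 H2]]] := long_chord _ _ _ _ _ _ _ cv h1 h1' hc kT.
    by have := top1 _ _ H1 H2; nra.
  have [X [th [t0 t1' H1 H2]]] := long_chord _ _ _ _ _ _ _ cv h1 h1' hc kB.
  by have := bot1 _ _ H1 H2; nra.
pose mu := (x1 - xx0) / (w1 - w0).
have mue : mu * (w1 - w0) = x1 - xx0 by rewrite /mu divfK // subr_eq0 gt_eqF.
have [j /andP[j1 j2]] := nearest_int mu.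
(* An integer shear leaves a slope between -1/2 and 1/2. A negative one is made positive by a
   reflection, with the origin at the right end of the lowest unit chord. *)
have [M0|M0] := lerP 0 (mu - j%:~R).
  have un : unimodular 1 j 0 1 by left; ring.
  apply: (tr_narrow _ _ _ _ _ xx0 w0 _ _ un).
  have e1 X Y : tr R 1 j 0 1 xx0 w0 k X Y = k (X + j%:~R * Y + xx0) (Y + w0).
    by rewrite /tr mul1r mul0r mul1r add0r.
  exists 1, 0; split; first by case.
  move=> X Y X' Y' H H'; rewrite mul1r mul0r addr0.
  apply: (frame_row (tr R 1 j 0 1 xx0 w0 k) (w1 - w0) (mu - j%:~R) h _ _ _ _ _ _ _ _ _ _ _ _ _ _ _ H H').
  - exact: tr_body.
  - exact: tr_triangle_free.
  - by rewrite e1 mulr0 !add0r.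
  - by rewrite e1 mulr0 addr0 add0r addrC.
  - rewrite e1; move: u1; congr (k _ _); last by ring.
    by rewrite mulrBl mue; ring.
  - rewrite e1; move: u1'; congr (k _ _); last by ring.
    by rewrite mulrBl mue; ring.
  - move=> a b; rewrite !e1 => A1 A2.
    have A3 : k (a + j%:~R * b + xx0 + 1) (b + w0) by move: A2; congr (k _ _); ring.
    by have := top1 _ _ A1 A3; have := bot1 _ _ A1 A3; move=> *; apply/andP; split; lra.
  - by lra.
  - by apply/andP.
  - by move=> a b a' b'; rewrite !e1 => A1 A2; have := hh _ _ _ _ A1 A2; lra.
  - exists (xT - xx0 - j%:~R * (yT - w0)), (yT - w0), (xB - xx0 - j%:~R * (yB - w0)), (yB - w0).
    split; last by lra.
      by rewrite e1; move: kT; congr (k _ _); ring.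
    by rewrite e1; move: kB; congr (k _ _); ring.
have un : unimodular (-1) j 0 1 by right; ring.
apply: (tr_narrow _ _ _ _ _ (xx0 + 1) w0 _ _ un).
have e1 X Y : tr R (-1) j 0 1 (xx0 + 1) w0 k X Y = k (- X + j%:~R * Y + xx0 + 1) (Y + w0).
  by rewrite /tr rmorphN1 mulN1r mul0r mul1r add0r addrA.
exists 1, 0; split; first by case.
move=> X Y X' Y' H H'; rewrite mul1r mul0r addr0.
apply: (frame_row (tr R (-1) j 0 1 (xx0 + 1) w0 k) (w1 - w0) (j%:~R - mu) h _ _ _ _ _ _ _ _ _ _ _ _ _ _ _ H H').
- exact: tr_body.
- exact: tr_triangle_free.
- by rewrite e1 mulr0 oppr0 !add0r.
- by rewrite e1; move: v1; congr (k _ _); ring.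
- rewrite e1; move: u1'; congr (k _ _); last by ring.
  by rewrite mulrBl mue; ring.
- rewrite e1; move: u1; congr (k _ _); last by ring.
  by rewrite mulrBl mue; ring.
- move=> a b; rewrite !e1 => A1 A2.
  have A3 : k (- a + j%:~R * b + xx0) (b + w0) by move: A2; congr (k _ _); ring.
  by have := top1 _ _ A3 A1; have := bot1 _ _ A3 A1; move=> *; apply/andP; split; lra.
- by lra.
- by apply/andP; split; lra.
- by move=> a b a' b'; rewrite !e1 => A1 A2; have := hh _ _ _ _ A1 A2; lra.
- exists (- (xT - xx0 - 1 - j%:~R * (yT - w0))), (yT - w0), (- (xB - xx0 - 1 - j%:~R * (yB - w0))), (yB - w0).
  split; last by lra.
    by rewrite e1; move: kT; congr (k _ _); ring.
  by rewrite e1; move: kB; congr (k _ _); ring.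
Qed.
End RRow.

(** * Arbitrary integer directions, and the passage to the limit *)

Section RStep.
Variable R : realType.
Implicit Types (k : R -> R -> Prop) (p q r s : int).

Lemma primitive_part (u v : int) : ~ (u = 0 /\ v = 0) ->
  exists g u' v' a b : int, [/\ 0 < g, u = g * u', v = g * v' & a * u' + b * v' = 1].
Proof.
move=> nz; have g0 : gcdz u v != 0.
  by apply/eqP => /eqP; rewrite gcdz_eq0 => /andP[/eqP ? /eqP ?]; apply: nz.
have [a [b hab]] := Bezoutz u v.
have [u' eu] := dvdzP (dvdz_gcdl u v); have [v' ev] := dvdzP (dvdz_gcdr u v).
have gp : 0 < gcdz u v by rewrite lt_neqAle eq_sym g0.
exists (gcdz u v), u', v', a, b.
move: (gcdz u v) => g in eu ev g0 gp hab *.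
split=> //; [by rewrite mulrC | by rewrite mulrC |].
by apply: (mulIf g0); rewrite mul1r -[RHS]hab eu ev; ring.
Qed.

(** The direction divided by its gcd [g >= 1] is primitive and still bounds the width by [h]; a
    unimodular change makes it the vertical coordinate. *)
Lemma real_step k h : body R k -> triangle_free R k -> 2 <= h -> narrow R k h -> narrow R k (1 + h / 2).
Proof.
move=> bk tf h2 [u [v [nz hn]]].
have [g [u' [v' [a [b [g0 eu ev hab]]]]]] := primitive_part _ _ nz.
have un : unimodular v' a (- u') b by left; rewrite -hab; ring.
apply: (tr_narrow _ _ _ _ _ 0 0 _ _ un); apply: row_step => //.
- exact: tr_body.
- exact: tr_triangle_free.
move=> X Y X' Y'; rewrite /tr !addr0 => H H'.
have := hn _ _ _ _ H H'.
have habR : a%:~R * u'%:~R + b%:~R * v'%:~R = 1 :> R by rewrite -!intrM -intrD hab.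
have g1 : 1 <= g%:~R :> R by rewrite ler1z -gtz0_ge1.
rewrite eu ev !intrM rmorphN /=.
move: (a%:~R) (b%:~R) (u'%:~R) (v'%:~R) (g%:~R) habR g1 => A B U V G e G1.
have -> : G * U * (V * X + A * Y - (V * X' + A * Y')) + G * V * (- U * X + B * Y - (- U * X' + B * Y'))
   = G * ((A * U + B * V) * (Y - Y')) by ring.
by rewrite e mul1r; have [?|?] := lerP 0 (Y - Y'); nra.
Qed.

Lemma narrow_le k c c' : c <= c' -> narrow R k c -> narrow R k c'.
Proof.
by move=> cc [u [v [nz h]]]; exists u, v; split=> // x y x' y' a b; apply: le_trans (h _ _ _ _ a b) cc.
Qed.

Lemma narrow_sub k k' c : (forall x y, k x y -> k' x y) -> narrow R k' c -> narrow R k c.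
Proof.
by move=> kk [u [v [nz h]]]; exists u, v; split=> // x y x' y' /kk a /kk b; exact: h.
Qed.

Lemma attains_narrow k : attains R k -> (exists x y, k x y) -> exists2 c, 2 <= c & narrow R k c.
Proof.
move=> at_ ne; have [x [y [_ h1]]] := at_ 1 0 ne; have [x' [y' [_ h2]]] := at_ (-1) 0 ne.
exists (Num.max 2 (x - x')); first by rewrite le_max lexx.
apply: (@narrow_le _ (x - x')); first by rewrite le_max lexx orbT.
exists 1, 0; split; first by case.
by move=> a b a' b' /h1 u1 /h2 u2; lra.
Qed.

Lemma real_narrow k ep : body R k -> triangle_free R k -> (exists x y, k x y) -> 0 < ep -> narrow R k (2 + ep).
Proof.
move=> bk tf ne ep0.
(* The restriction [2 <= c] makes [real_step] applicable to every member and bounds the set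
   below. *)
pose E : set R := fun c => 2 <= c /\ narrow R k c.
have hE : has_inf E.
  have [c c2 hc] := attains_narrow k (body_attains _ _ bk) ne.
  by split; [exists c | exists 2 => z []].
have i2 : inf E <= 2.
  rewrite leNgt; apply/negP => i2.
  (* The tolerance gives [c < 2 * inf E - 2], so that [1 + c / 2] falls below the infimum. *)
  have [||c [c2 hc] lc] := @inf_adherent _ E (inf E - 2); first by lra.
    exact: hE.
  have hc' : E (1 + c / 2) by split; [lra | exact: real_step].
  have := ge_inf hE.2 hc'; lra.
have [c [c2 hc] lc] := inf_adherent ep0 hE.
by apply: narrow_le hc; lra.
Qed.
End RStep.

(** * Inequalities for the bound 10/3 *)

Section ZAlg.
Variable R : realFieldType.
Implicit Types al be eta rho : R.

(** This is twice the value of the polynomial of [overhang_poly_ge0] at [rho = 1 + be / 2],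
    [eta = 1 - al / 2], where the two upper bounds on [eta] coincide. It vanishes at
    [al = be = 2 / 3], the values of the extremal triangle. *)
Lemma overhang_poly_kink al be : be <= al -> 1 / 3 < be -> 4 / 3 < al + be -> 7 * al < 6 + 3 * be ->
  0 <= 14 / 3 * al - 4 + 8 / 3 * be - be * (al + be).
Proof.
move=> h1 h2 h3 h4.
have q1 : 0 <= (al - be) * (al + be) by rewrite mulr_ge0 //; lra.
have q2 : 0 <= (al + be - 4 / 3) * (6 - (al + be)) by rewrite mulr_ge0 //; lra.
nra.
Qed.

(** The expression is affine in [eta] with slope [c]. For negative [c] the largest admissible [eta]
    is the worst; which of the two hypotheses limits it changes at [rho = 1 + be / 2]. *)
Lemma overhang_poly_ge0 al be eta rho : be <= al -> 1 / 3 < be -> 4 / 3 < al + be -> 7 * al < 6 + 3 * be ->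
  0 <= eta <= 1 -> be <= rho -> al * rho <= (2 + be) * (1 - eta) ->
  (2 + al) * (rho - 1) <= be * (2 - eta) ->
  0 <= (7 / 3 - rho) * (al * rho + be * eta) - 2 * eta * rho + be * eta.
Proof.
move=> h1 h2 h3 h4 /andP[e0 e1] hr r1 r2.
have k0 := overhang_poly_kink _ _ h1 h2 h3 h4.
have be1 : be < 3 / 2 by lra.
have a0 : 0 < al by lra.
have rs : rho <= 7 / 3.
  rewrite leNgt; apply/negP => rb.
  have : (2 + al) * (4 / 3) <= (2 + al) * (rho - 1) by apply: ler_wpM2l; lra.
  have : be * eta >= 0 by rewrite mulr_ge0 //; lra.
  lra.
have P : 0 <= (7 / 3 - rho) * (al * rho) by rewrite mulr_ge0 ?mulr_ge0 //; lra.
set c := (10 / 3) * be - (2 + be) * rho.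
have -> : (7 / 3 - rho) * (al * rho + be * eta) - 2 * eta * rho + be * eta =
          (7 / 3 - rho) * (al * rho) + eta * c by rewrite /c; field.
have [c0|c0] := lerP 0 c; first by rewrite addr_ge0 // mulr_ge0.
have [rl|rl] := lerP rho (1 + be / 2).
  have b0 : 0 < 2 + be by lra.
  rewrite -(pmulr_rge0 _ b0).
  have s1 : 0 <= - c * ((2 + be) * (1 - eta) - al * rho) by rewrite mulr_ge0 //; lra.
  have s2 : 0 <= (1 + be / 2 - rho) * be by rewrite mulr_ge0 //; lra.
  have s3 : 0 <= rho * (14 / 3 * al - 4 + 8 / 3 * be - be * (al + be)) by rewrite mulr_ge0 //; lra.
  have -> : (2 + be) * ((7 / 3 - rho) * (al * rho) + eta * c) =
    - c * ((2 + be) * (1 - eta) - al * rho) + (20 / 3) * ((1 + be / 2 - rho) * be)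
    + rho * (14 / 3 * al - 4 + 8 / 3 * be - be * (al + be)).
    by rewrite /c; field.
  lra.
have b0 : 0 < be by lra.
rewrite -(pmulr_rge0 _ b0).
have s1 : 0 <= - c * (be * (2 - eta) - (2 + al) * (rho - 1)) by rewrite mulr_ge0 //; lra.
set d := rho - 1 - be / 2.
have d0 : 0 <= d by rewrite /d; lra.
have s2 : 0 <= d * (6 + 3 * al - 7 * be) by rewrite mulr_ge0 //; lra.
have s3 : 0 <= (4 + 2 * al + 2 * be) * (d * d) by rewrite mulr_ge0 ?mulr_ge0 //; lra.
have s4 : 0 <= be * (14 / 3 * al - 4 + 8 / 3 * be - be * (al + be)) by rewrite mulr_ge0 //; lra.
have -> : be * ((7 / 3 - rho) * (al * rho) + eta * c) =
  - c * (be * (2 - eta) - (2 + al) * (rho - 1)) + (2 / 3) * (d * (6 + 3 * al - 7 * be))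
  + (4 + 2 * al + 2 * be) * (d * d) + (1 / 2) * (be * (14 / 3 * al - 4 + 8 / 3 * be - be * (al + be))).
  by rewrite /c /d; field.
lra.
Qed.

Lemma bulge_poly_le al be eta g l : be <= al -> 1 / 3 < be -> be < 1 -> 4 / 3 < al + be -> 0 <= eta <= 1 ->
  g * (al * (1 - be) + be * (1 - eta)) <= (1 - eta) * (2 - be) ->
  l * (al + be * eta) <= eta * (2 - be) -> g + l <= 7 / 3.
Proof.
move=> h1 h2 h3 h4 /andP[e0 e1] hg hl.
set P := al * (1 - be) + be * (1 - eta) in hg; set Q := al + be * eta in hl.
have P0 : 0 < P.
  by rewrite /P; apply: ltr_wpDr; [rewrite mulr_ge0 //; lra|rewrite mulr_gt0 //; lra].
have Q0 : 0 < Q by rewrite /Q; apply: ltr_wpDr; [rewrite mulr_ge0 //; lra|lra].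
rewrite -(ler_pM2r (mulr_gt0 P0 Q0)).
have u1 := ler_wpM2r (ltW Q0) hg; have u2 := ler_wpM2r (ltW P0) hl.
suff : (1 - eta) * (2 - be) * Q + eta * (2 - be) * P <= 7 / 3 * (P * Q) by lra.
rewrite -subr_ge0.
have -> : 7 / 3 * (P * Q) - ((1 - eta) * (2 - be) * Q + eta * (2 - be) * P) =
  (be * ((13 * be - 12) * (eta * (1 - eta)) + (1 - eta) * (al * (10 * be - 6))) +
   al * (1 - be) * (7 * al + 10 * be - 6)) / 3.
  by rewrite /P /Q; field.
apply: divr_ge0 => //.
have x0 : 0 <= eta * (1 - eta) by rewrite mulr_ge0 //; lra.
have x1 : eta * (1 - eta) <= 1 / 4 by clear; have := sqr_ge0 (eta - 1 / 2); rewrite expr2; lra.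
have y0 : 0 <= (1 - eta) * al by rewrite mulr_ge0 //; lra.
have y1 : (1 - eta) * al <= al by rewrite -subr_ge0 -{1}[al]mul1r -mulrBl opprB addrCA subrr addr0 mulr_ge0 //; lra.
move: (eta * (1 - eta)) x0 x1 => X x0 x1.
have -> : (1 - eta) * (al * (10 * be - 6)) = ((1 - eta) * al) * (10 * be - 6) by ring.
move: ((1 - eta) * al) y0 y1 => Y y0 y1; clear - h1 h2 h3 h4 x0 x1 y0 y1.
(* The sign of [10 * be - 6] decides whether the term in [Y] is dropped or estimated at the extreme
   [Y = al]. *)
have [b6|b6] := lerP (6 / 10) be.
  have w1 : 0 <= be * (Y * (10 * be - 6)) by rewrite !mulr_ge0 //; lra.
  have w2 : be * ((17 * be - 6) * (1 - be)) <= al * ((7 * al + 10 * be - 6) * (1 - be)).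
    apply: ler_pM => //; first by lra.
      by rewrite mulr_ge0 //; lra.
    by apply: ler_wpM2r; lra.
  have w3 : 0 <= be * ((13 * be - 12) * X + (17 * be - 6) * (1 - be)).
    apply: mulr_ge0; first by lra.
    have [b12|b12] := lerP (12 / 13) be.
      by apply: addr_ge0; apply: mulr_ge0; lra.
    have : (13 * be - 12) * X >= (13 * be - 12) * (1 / 4) by apply: ler_wnM2l; lra.
    have : 0 <= (be - 6 / 10) * (12 / 13 - be) by apply: mulr_ge0; lra.
    by lra.
  by lra.
have w1 : (13 * be - 12) * X >= (13 * be - 12) * (1 / 4) by apply: ler_wnM2l; lra.
have w2 : Y * (10 * be - 6) >= al * (10 * be - 6) by apply: ler_wnM2r; lra.
have w3 : be * ((13 * be - 12) * (1 / 4) + al * (10 * be - 6)) <=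
   be * ((13 * be - 12) * X + Y * (10 * be - 6)) by apply: ler_wpM2l; lra.
suff : 0 <= be * ((13 * be - 12) * (1 / 4) + al * (10 * be - 6)) +
       al * (1 - be) * (7 * al + 10 * be - 6) by lra.
have w4 : al * (1 - be) * (10 / 3 + 3 * be) <= al * (1 - be) * (7 * al + 10 * be - 6).
  by apply: ler_wpM2l; [apply: mulr_ge0|]; lra.
(* The numbers 19/42 and, below, 26/57 are the vertices of the two quadratics in [be] whose
   positivity is needed. *)
have w5 : 0 <= (be - 19 / 42) ^+ 2 by exact: sqr_ge0.
have w6 : (2 / 3) * (7 * be ^+ 2 - 19 / 3 * be + 10 / 3) <= al * (7 * be ^+ 2 - 19 / 3 * be + 10 / 3).
  by apply: ler_wpM2r; lra.
have w7 : 0 <= (be - 26 / 57) ^+ 2 by exact: sqr_ge0.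
lra.
Qed.

(** An overhang above 2 forces [al * be < eta * ze] after elimination of [y]. The inequality of
    arithmetic and geometric means, applied to the third-last hypothesis, then contradicts
    [1 < al * be * (3 + al + be)]. *)
Lemma wedge_le2 al be eta ze y A : 1 / 3 < be -> be <= al -> 4 / 3 < al + be -> 0 <= eta -> 0 <= ze ->
  (1 + al) * ze + (1 + be) * eta < 2 - 2 * al * be ->
  al * A <= (1 + y) * (al + eta) -> be * A <= (1 - y) * (be + ze) -> A <= 2.
Proof.
move=> h1 h2 h3 e0 z0 cr q1 q2; rewrite leNgt; apply/negP => A2.
have a0 : 0 < al by lra.
have b0 : 0 < be by lra.
have q : 1 < al * be * (3 + al + be).
  have w1 : 0 <= (al - 1 / 3) * (be - 1 / 3) by apply: mulr_ge0; lra.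
  have w2 : 1 / 3 <= al * be by lra.
  have w3 : 1 / 3 * (3 + al + be) <= al * be * (3 + al + be) by apply: ler_wpM2r; lra.
  by lra.
have g1 : al * 2 < (1 + y) * (al + eta) by apply: lt_le_trans q1; rewrite ltr_pM2l.
have g2 : be * 2 < (1 - y) * (be + ze) by apply: lt_le_trans q2; rewrite ltr_pM2l.
have r1 : al * 2 * (be + ze) < (1 + y) * (al + eta) * (be + ze) by rewrite ltr_pM2r // ltr_wpDr.
have r2 : be * 2 * (al + eta) < (1 - y) * (be + ze) * (al + eta) by rewrite ltr_pM2r // ltr_wpDr.
have g4 : al * be < eta * ze by clear - r1 r2; lra.
have pp : 0 < (1 + al) * (1 + be) by rewrite mulr_gt0 // addr_gt0.
have l1 : al * be * ((1 + al) * (1 + be)) < eta * ze * ((1 + al) * (1 + be)) by rewrite ltr_pM2r.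
have l3 : ((1 + al) * ze + (1 + be) * eta) ^+ 2 <= (2 - 2 * al * be) ^+ 2.
  have n0 : 0 <= (1 + al) * ze + (1 + be) * eta by rewrite addr_ge0 // mulr_ge0 // addr_ge0 // ltW.
  by rewrite lerXn2r ?nnegrE //; lra.
have l4 := sqr_ge0 ((1 + al) * ze - (1 + be) * eta).
clear - q l1 l3 l4; lra.
Qed.

Lemma wedge_pair_le al be (b t y A y' C : R) : 0 < be -> be <= al -> 4 / 3 < al + be ->
  -1 <= y <= 1 -> -1 <= y' <= 1 -> 0 <= b <= 1 -> 0 <= t <= 1 ->
  al * A <= (1 + y) * b -> be * A <= (1 - y) * t ->
  al * C <= (1 + y') * (1 - b) -> be * C <= (1 - y') * (1 - t) -> A + C <= 3 / 2.
Proof.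
move=> b0 ab s /andP[y1 y2] /andP[y3 y4] hb ht q1 q2 q3 q4.
have e z : 2 - (1 + z) = 1 - z :> R by ring.
have a0 : 0 < al by exact: lt_le_trans ab.
have s0 : 0 < al + be by rewrite addr_gt0.
have f (z : R) : -1 <= z -> 0 <= 1 + z by move=> hz; rewrite -lerBlDl sub0r.
have f' (z : R) : z <= 1 -> 1 + z <= 2 by move=> hz; rewrite -[2]/(1 + 1) lerD2l.
have := @wedge_pair _ al be 2 (1 + y) b t A (1 + y') C (ltW a0) (ltW b0) s0
  (f _ y1) (f' _ y2) (f _ y3) (f' _ y4) hb ht q1.
rewrite !e => /(_ q2 q3 q4) hh; rewrite leNgt; apply/negP => hc.
have : 3 / 2 * (al + be) < (A + C) * (al + be) by rewrite ltr_pM2r.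
clear - hh s; lra.
Qed.

(** Because of [al * l <= 2 * eta], the last hypothesis persists when [tau] is raised to [rho]; what
    remains is [overhang_poly_ge0]. *)
Lemma overhang_le al be eta tau rho l : be <= al -> 1 / 3 < be -> 4 / 3 < al + be ->
  7 * al < 6 + 3 * be -> 0 <= eta <= 1 -> be <= tau -> tau <= rho ->
  al * rho <= (2 + be) * (1 - eta) -> (2 + al) * (rho - 1) <= be * (2 - eta) ->
  al * l <= 2 * eta -> l * (al * tau + be * eta) <= eta * (2 * tau - be) -> rho + l <= 7 / 3.
Proof.
move=> h1 h2 h3 h4 e01 t0 tr r1 r2 l1 l2.
have phi := overhang_poly_ge0 _ _ _ _ h1 h2 h3 h4 e01 (le_trans t0 tr) r1 r2.
have a0 : 0 < al by lra.
have D0 : 0 < al * rho + be * eta.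
  case/andP: e01 => e0 _.
  by apply: ltr_wpDr; [apply: mulr_ge0; lra | apply: mulr_gt0; lra].
have m0 : 0 <= (rho - tau) * (2 * eta - al * l) by rewrite mulr_ge0 // subr_ge0.
have : l * (al * rho + be * eta) <= (7 / 3 - rho) * (al * rho + be * eta) by clear - phi m0 l2; lra.
by rewrite ler_pM2r // => {}l2; clear - l2; lra.
Qed.

(** The bound on [g] is weakest at [tau = be], the one on [l] at [tau = 1]; taking both extremes at
    once eliminates [tau]. *)
Lemma bulge_le al be eta tau g l y : be <= al -> 1 / 3 < be -> 4 / 3 < al + be ->
  0 <= eta <= 1 -> be <= tau -> tau < 1 -> y <= 1 ->
  al * g <= (1 + y) * (1 - eta) -> be * (g - 1) <= (1 - y) * (1 - tau) ->
  al * l <= 2 * eta -> l * (al * tau + be * eta) <= eta * (2 * tau - be) -> g + l <= 7 / 3.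
Proof.
move=> h1 h2 h3 e01 t0 t1 y1 p1 p2 l1 l2; case/andP: (e01) => e0 e1.
have e1' : 0 <= 1 - eta by rewrite subr_ge0.
have t1' : 0 <= 1 - tau by rewrite subr_ge0 ltW.
apply: (bulge_poly_le al be eta) => //; first exact: le_lt_trans t1.
  have a1 : 0 <= (tau - be) * (2 * (1 - eta) - al * g).
    apply: mulr_ge0; first by rewrite subr_ge0.
    have : 0 <= (1 - y) * (1 - eta) by rewrite mulr_ge0 // subr_ge0.
    by clear - p1; lra.
  have := ler_wpM2r t1' p1; have := ler_wpM2r e1' p2; clear - a1; lra.
have : 0 <= (1 - tau) * (2 * eta - al * l) by rewrite mulr_ge0 // subr_ge0.
clear - l2; lra.
Qed.

(** For [width_gap2]: [m] is the distance of a point below level -1 and [v] the excess of its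
    [x - y] over 2. The value 1/3 is what 10/3 leaves after a unit strip and an overhang of 2 on the
    other side. *)
Lemma below_excess_le al be ze m v : 1 / 3 < be -> 7 * al < 6 + 3 * be -> 0 <= ze -> 0 <= m -> m <= al ->
  (2 + be) * v <= m * (1 - be - ze) -> v <= 1 / 3.
Proof.
move=> h1 h2 z0 m0 m1 hv; rewrite leNgt; apply/negP => v3.
have q1 : 0 <= m * ze by rewrite mulr_ge0.
have q2 : (2 + be) * (1 / 3) < (2 + be) * v by rewrite ltr_pM2l; lra.
have [bl|bl] := lerP 1 be.
  by have : 0 <= m * (be - 1) by [apply: mulr_ge0; lra]; lra.
have q3 : m * (1 - be) <= al * (1 - be) by apply: ler_wpM2r; lra.
have q4 : 7 * al * (1 - be) <= (6 + 3 * be) * (1 - be) by apply: ler_wpM2r; lra.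
have := sqr_ge0 (be - 1 / 3); lra.
Qed.

Lemma above_excess_le al be eta m v : 0 < al -> be <= al -> 0 <= eta -> 0 <= m -> m <= be ->
  (2 + al) * v <= m * (1 - al - eta) -> v <= 1 / 3.
Proof.
move=> h1 h2 z0 m0 m1 hv; rewrite leNgt; apply/negP => v3.
have q1 : 0 <= m * eta by rewrite mulr_ge0.
have q2 : (2 + al) * (1 / 3) < (2 + al) * v by rewrite ltr_pM2l; lra.
have [bl|bl] := lerP 1 al.
  by have : 0 <= m * (al - 1) by [apply: mulr_ge0; lra]; lra.
have q3 : m * (1 - al) <= al * (1 - al) by apply: ler_wpM2r; lra.
have := sqr_ge0 (al - 1 / 3); lra.
Qed.
End ZAlg.

(** * Bodies through (0,0) and (1,0) avoiding the lattice points at levels 1 and -1 *)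

Section ZFrame.
Variable R : realFieldType.
(* The highest and lowest points are [(xt, 1 + be)] and [(eta, - (1 + al))]. *)
Variables (k : R -> R -> Prop) (n al be xt eta : R).
Hypotheses (cv : cvx R k) (k00 : k 0 0) (k10 : k 1 0).
Hypotheses (kT : k xt (1 + be)) (top : forall x y, k x y -> y <= 1 + be).
Hypotheses (kB : k eta (- (1 + al))) (bot : forall x y, k x y -> - (1 + al) <= y).
Hypotheses (lev1 : forall x, k x 1 -> n < x < n + 1) (levN1 : forall x, k x (-1) -> 0 < x < 1).
Hypotheses (be13 : 1 / 3 < be) (beal : be <= al) (albe : 4 / 3 < al + be) (alN : 7 * al < 6 + 3 * be).

Lemma below_strip x y : k x y -> y <= -1 -> 0 <= x <= 1.
Proof.
move=> h hy.
have y0 : 0 < 0 - y by lra.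
have b : y <= (-1 : R) <= 0 by apply/andP; split; lra.
have cc := cvx_between _ _ _ _ _ _ (-1) cv h k00 b ltac:(idtac; lra); have /andP[l1 _] := levN1 _ cc.
have dd := cvx_between _ _ _ _ _ _ (-1) cv h k10 b ltac:(idtac; lra); have /andP[_ l2] := levN1 _ dd.
by move: l1 l2; rewrite ltr_pdivlMr // ltr_pdivrMr // => l1 l2; apply/andP; split; lra.
Qed.

Lemma above_strip x y : k x y -> 1 <= y -> n * y <= x <= n * y + 1.
Proof.
move=> h hy.
have y0 : 0 < y - 0 by lra.
have b : 0 <= (1 : R) <= y by apply/andP; split; lra.
have cc := cvx_between _ _ _ _ _ _ 1 cv k00 h b ltac:(idtac; lra); have /andP[l1 _] := lev1 _ cc.
have dd := cvx_between _ _ _ _ _ _ 1 cv k10 h b ltac:(idtac; lra); have /andP[_ l2] := lev1 _ dd.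
by move: l1 l2; rewrite ltr_pdivlMr // ltr_pdivrMr // => l1 l2; apply/andP; split; lra.
Qed.

Lemma wedge_bottom x y : k x y -> -1 <= y ->
  al * - x <= (1 + y) * eta /\ al * (x - 1) <= (1 + y) * (1 - eta).
Proof.
move=> h hy; have h1 := be13; have h2 := beal.
have y0 : 0 < y - - (1 + al) by lra.
have b : - (1 + al) <= -1 <= y by apply/andP; split; lra.
have cc := cvx_between _ _ _ _ _ _ (-1) cv kB h b ltac:(idtac; lra); have /andP[] := levN1 _ cc.
by rewrite ltr_pdivlMr // ltr_pdivrMr // => l1 l2; split; lra.
Qed.

Lemma wedge_top x y : k x y -> y <= 1 ->
  be * (n - x) <= (1 - y) * (xt - n) /\ be * (x - n - 1) <= (1 - y) * (n + 1 - xt).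
Proof.
move=> h hy; have h1 := be13.
have y0 : 0 < 1 + be - y by lra.
have b : y <= 1 <= 1 + be by apply/andP; split; lra.
have cc := cvx_between _ _ _ _ _ _ 1 cv h kT b ltac:(idtac; lra); have /andP[] := lev1 _ cc.
by rewrite ltr_pdivlMr // ltr_pdivrMr // => l1 l2; split; lra.
Qed.

Lemma above_bottom x y : k x y -> 1 <= y ->
  (2 + al) * (x - (n + 1)) <= (y - 1) * (n + 1 - eta).
Proof.
move=> h hy; have h1 := be13; have h2 := beal.
have y0 : 0 < y - - (1 + al) by lra.
have b : - (1 + al) <= 1 <= y by apply/andP; split; lra.
have cc := cvx_between _ _ _ _ _ _ 1 cv kB h b ltac:(idtac; lra); have /andP[_] := lev1 _ cc.
by rewrite ltr_pdivrMr // => l2; lra.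
Qed.

Lemma below_top x y : k x y -> y <= -1 ->
  (2 + be) * (x - 1) <= (-1 - y) * (1 - xt).
Proof.
move=> h hy; have h1 := be13.
have y0 : 0 < 1 + be - y by lra.
have b : y <= -1 <= 1 + be by apply/andP; split; lra.
have cc := cvx_between _ _ _ _ _ _ (-1) cv h kT b ltac:(idtac; lra); have /andP[_] := levN1 _ cc.
by rewrite ltr_pdivrMr // => l2; lra.
Qed.

Lemma eta01 : 0 <= eta <= 1.
Proof. by have h1 := be13; have h2 := beal; apply: below_strip kB _; lra. Qed.

Lemma xt_strip : n * (1 + be) <= xt <= n * (1 + be) + 1.
Proof. by have h1 := be13; apply: above_strip kT _; lra. Qed.

Lemma level0_lt x : ~ k 2 0 -> k x 0 -> x < 2.
Proof.
move=> k20 h; rewrite ltNge; apply/negP => x2; apply: k20.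
by apply: (cvx_hor _ _ _ _ _ _ cv k00 h); lra.
Qed.

Lemma crossing_lt : ~ k 2 0 -> (1 + al) * xt + (1 + be) * eta < 2 * (2 + al + be).
Proof.
move=> k20; have h1 := be13; have h2 := beal.
have y0 : 0 < 1 + be - - (1 + al) by lra.
have b : - (1 + al) <= 0 <= 1 + be by apply/andP; split; lra.
have cc := cvx_between _ _ _ _ _ _ 0 cv kB kT b ltac:(idtac; lra); have := level0_lt _ k20 cc.
by rewrite ltr_pdivrMr // => l2; lra.
Qed.

Lemma width_gap0 x y x' y' : n = 0 -> k x y -> k x' y' -> x - x' <= 10 / 3.
Proof.
move=> n0 h h'; have h1 := be13; have h2 := beal; have h3 := albe.
have := xt_strip; rewrite n0 !mul0r add0r => xt01.
have inner a b : k a b -> -1 < b -> b < 1 ->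
  [/\ al * - a <= (1 + b) * eta, be * - a <= (2 - (1 + b)) * xt,
    al * (a - 1) <= (1 + b) * (1 - eta) & be * (a - 1) <= (2 - (1 + b)) * (1 - xt)].
  move=> hab b1 b2; have [w1 w2] := wedge_bottom _ _ hab (ltW b1).
  have [] := wedge_top _ _ hab (ltW b2); rewrite n0 => w3 w4.
  by split; lra.
have outer a b : k a b -> (b <= -1) || (1 <= b) -> 0 <= a <= 1.
  move=> hab /orP[hb|hb]; first exact: below_strip hab hb.
  by have := above_strip _ _ hab hb; rewrite n0 mul0r add0r.
(* A point beyond the levels 1 and -1 lies in the strip, so [(1, 0)] is at least as far to the right
   and may replace it; [(0, 0)] does the same on the left. *)
have [X [Y [hX Y1 Y2 xX]]] : exists X Y, [/\ k X Y, -1 < Y, Y < 1 & x <= X].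
  have [/(outer _ _ h) /andP[_ ?]|] := boolP ((y <= -1) || (1 <= y)).
    by exists 1, 0; split=> //; lra.
  by rewrite negb_or -!ltNge => /andP[? ?]; exists x, y.
have [X' [Y' [hX' Y1' Y2' xX']]] : exists X Y, [/\ k X Y, -1 < Y, Y < 1 & X <= x'].
  have [/(outer _ _ h') /andP[? _]|] := boolP ((y' <= -1) || (1 <= y')).
    by exists 0, 0; split=> //; lra.
  by rewrite negb_or -!ltNge => /andP[? ?]; exists x', y'.
have [_ _ p1 p2] := inner _ _ hX Y1 Y2; have [q1 q2 _ _] := inner _ _ hX' Y1' Y2'.
suff : - X' + (X - 1) <= 3 / 2 by lra.
have b0 : 0 < be by lra.
have e z : 2 - (1 + z) = 1 - z :> R by ring.
rewrite !e in q2 p2.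
by apply: (wedge_pair_le _ al be eta xt Y' _ Y _ b0 h2 h3 _ _ eta01 xt01 q1 q2 p1 p2); rewrite !ltW.
Qed.

(** The witness is the overhang to the left of 0, or 0 if there is none; the last bound eliminates
    the level from the two wedge inequalities. *)
Lemma left_overhang x y : n = 1 -> k x y -> exists l, [/\ - x <= l, al * l <= 2 * eta &
  l * (al * (xt - 1) + be * eta) <= eta * (2 * (xt - 1) - be)].
Proof.
move=> n1 h; have h1 := be13; have h2 := beal.
have := xt_strip; rewrite n1 mul1r => /andP[xt1 _]; have /andP[e0 e1] := eta01.
have xt0 : 0 <= xt - 1 by lra.
have [x0|x0] := lerP 0 x.
  exists 0; rewrite mulr0 mul0r oppr_le0; split => //; first by rewrite mulr_ge0.
  by rewrite mulr_ge0 //; lra.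
have y1 : -1 < y.
  by rewrite ltNge; apply/negP => /(below_strip _ _ h) /andP[]; rewrite leNgt x0.
have y2 : y < 1.
  by rewrite ltNge; apply/negP => y2; have /andP[] := above_strip _ _ h y2; rewrite n1; lra.
have [q1 _] := wedge_bottom _ _ h (ltW y1); have [q2 _] := wedge_top _ _ h (ltW y2).
rewrite n1 in q2.
exists (- x); split=> //.
  have : 0 <= (1 - y) * eta by rewrite mulr_ge0 // subr_ge0 ltW.
  by lra.
by have := ler_wpM2r xt0 q1; have := ler_wpM2r e0 q2; lra.
Qed.

Lemma high_points x y : n = 1 -> k x y -> 1 <= y ->
  al * (x - 1) <= (2 + be) * (1 - eta) /\ (2 + al) * (x - 1 - 1) <= be * (2 - eta).
Proof.
move=> n1 h y1; have tY := top _ _ h; have /andP[e0 e1] := eta01.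
have ym : -1 <= y by lra.
have [_ w2] := wedge_bottom _ _ h ym.
have := above_bottom _ _ h y1; rewrite n1 => w3.
have : 0 <= (1 + be - y) * (1 - eta) by rewrite mulr_ge0 // subr_ge0.
have : 0 <= (1 + be - y) * (2 - eta) by apply: mulr_ge0; lra.
by split; lra.
Qed.

(** The sharp case. Abscissae on the right are measured from 1, which leaves 7/3 for both overhangs:
    [overhang_le] serves when the right one is dominated by a point above level 1, [bulge_le] when
    it occurs between the levels -1 and 1. *)
Lemma width_gap1 x y x' y' : n = 1 -> k x y -> k x' y' -> x - x' <= 10 / 3.
Proof.
move=> n1 h h'; have h1 := be13; have h2 := beal.
have [l [xl l1 l2]] := left_overhang _ _ n1 h'.
have := xt_strip; rewrite n1 mul1r => /andP[xt1 _].
have t0 : be <= xt - 1 by lra.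
have sum g : x - 1 <= g -> g + l <= 7 / 3 -> x - x' <= 10 / 3 by move=> g1 g2; lra.
have fin rho : xt - 1 <= rho -> x - 1 <= rho -> al * rho <= (2 + be) * (1 - eta) ->
    (2 + al) * (rho - 1) <= be * (2 - eta) -> x - x' <= 10 / 3.
  move=> r1 r2 r3 r4; apply: (sum _ r2).
  exact: (overhang_le _ _ _ _ _ _ _ h2 h1 albe alN eta01 t0 r1 r3 r4 l1 l2).
have bT : 1 <= 1 + be by lra.
have [t1 t2] := high_points _ _ n1 kT bT.
have finT : x <= xt -> x - x' <= 10 / 3.
  by move=> xx; apply: (fin (xt - 1)) => //; rewrite lerD2r.
have [y1|y1] := lerP y (-1).
  by apply: finT; have /andP[] := below_strip _ _ h y1; lra.
have [y2|y2] := lerP 1 y.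
  have [xx|xx] := lerP x xt; first exact: finT.
  have [p1 p2] := high_points _ _ n1 h y2.
  by apply: (fin (x - 1)) => //; rewrite lerD2r ltW.
have [_] := wedge_top _ _ h (ltW y2); rewrite n1 => p2.
have [_ p1] := wedge_bottom _ _ h (ltW y1).
have b0 : 0 < be by lra.
have [xt3|xt3] := lerP 2 xt.
  apply: finT; rewrite leNgt; apply/negP => xx.
  have : 0 < be * (x - 1 - 1) by rewrite mulr_gt0 //; lra.
  have : 0 <= (1 - y) * (xt - 2) by rewrite mulr_ge0 // subr_ge0 // ltW.
  by lra.
apply: (sum _ (lexx _)).
have p2' : be * (x - 1 - 1) <= (1 - y) * (1 - (xt - 1)) by rewrite opprB addrA.
have tau1 : xt - 1 < 1 by lra.
exact: (bulge_le _ _ _ _ _ _ _ _ h2 h1 albe eta01 t0 tau1 (ltW y2) p1 p2' l1 l2).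
Qed.

(** In the coordinate [x - y] the sections at levels 1 and -1 both lie in [(1, 2)]. [A] bounds the
    overhang to the left of 1; points beyond these levels have none and get the default
    [Y = A = 0]. *)
Lemma right_gap x y : n = 2 -> k x y -> exists Y A, [/\ -1 <= Y <= 1, al * A <= (1 + Y) * (al + eta),
  be * A <= (1 - Y) * (be + (xt - 2 * (1 + be))) & 1 - (x - y) <= A].
Proof.
move=> n2 h; have h1 := be13; have h2 := beal; have /andP[e0 e1] := eta01.
have := xt_strip; rewrite n2 => /andP[xt1 _].
have zero : 1 - (x - y) <= 0 -> exists Y A, [/\ -1 <= Y <= 1, al * A <= (1 + Y) * (al + eta),
    be * A <= (1 - Y) * (be + (xt - 2 * (1 + be))) & 1 - (x - y) <= A].
  by exists 0, 0; split=> //; lra.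
have [y1|y1] := lerP y (-1).
  by apply: zero; have /andP[] := below_strip _ _ h y1; lra.
have [y2|y2] := lerP 1 y.
  by apply: zero; have /andP[] := above_strip _ _ h y2; rewrite n2; lra.
have [a1 _] := wedge_bottom _ _ h (ltW y1); have [a2 _] := wedge_top _ _ h (ltW y2).
rewrite n2 in a2.
by exists y, (1 - (x - y)); split; rewrite ?(ltW y1) ?(ltW y2) //; lra.
Qed.

Lemma inner_gap x y : n = 2 -> k x y -> -1 < y -> y < 1 ->
  al * (x - y - 2) <= (1 + y) * (1 - (al + eta)) /\
  be * (x - y - 2) <= (1 - y) * (1 - (be + (xt - 2 * (1 + be)))).
Proof.
move=> n2 h y1 y2.
have [_ p1] := wedge_bottom _ _ h (ltW y1); have [_ p2] := wedge_top _ _ h (ltW y2).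
by rewrite n2 in p2; split; lra.
Qed.

(** The left overhang [A] is at most 2, which settles right overhangs up to 1/3. A larger one occurs
    only between the levels -1 and 1, where the two overhangs together are at most 3/2. *)
Lemma width_gap2 x y x' y' : n = 2 -> ~ k 2 0 -> k x y -> k x' y' -> (x - y) - (x' - y') <= 10 / 3.
Proof.
move=> n2 k20 h h'; have h1 := be13; have h2 := beal; have h3 := albe.
have := xt_strip; rewrite n2 => /andP[xt1 _]; have /andP[e0 e1] := eta01.
have cr := crossing_lt k20.
have [Y [A [Y1 q1 q2 hA]]] := right_gap _ _ n2 h'.
have inner := inner_gap _ _ n2 h.
have below y1 := below_top _ _ h y1; have above y2 := above_bottom _ _ h y2.
have bot_y := bot _ _ h; have top_y := top _ _ h.
set ze := xt - 2 * (1 + be) in q2 inner.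
have z0 : 0 <= ze by rewrite subr_ge0.
have crz : (1 + al) * ze + (1 + be) * eta < 2 - 2 * al * be by rewrite /ze; lra.
have a0 : 0 < al by lra.
have b0 : 0 < be by lra.
have A2 := wedge_le2 _ _ _ _ _ _ _ h1 h2 h3 e0 z0 crz q1 q2.
have [C0|C0] := lerP (x - y - 2) (1 / 3); first by lra.
have [y1|y1] := lerP y (-1).
  suff : x - y - 2 <= 1 / 3 by rewrite leNgt C0.
  apply: (below_excess_le _ al be ze (- 1 - y)) => //; [lra | lra |].
  by have := below y1; rewrite /ze; lra.
have [y2|y2] := lerP 1 y.
  suff : x - y - 2 <= 1 / 3 by rewrite leNgt C0.
  apply: (above_excess_le _ al be eta (y - 1)) => //; [lra | lra |].
  by have := above y2; rewrite n2; lra.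
have [r1 r2] := inner y1 y2.
have C1 : 0 < x - y - 2 by lra.
have u1 : al + eta <= 1.
  have yp : 0 < 1 + y by rewrite -ltrBlDl sub0r.
  by have := lt_le_trans (mulr_gt0 a0 C1) r1; rewrite pmulr_rgt0 // subr_gt0 => /ltW.
have u2 : be + ze <= 1.
  have yp : 0 < 1 - y by rewrite subr_gt0.
  by have := lt_le_trans (mulr_gt0 b0 C1) r2; rewrite pmulr_rgt0 // subr_gt0 => /ltW.
suff : A + (x - y - 2) <= 3 / 2 by lra.
apply: (wedge_pair_le _ al be (al + eta) (be + ze) Y _ y _ b0 h2 h3 _ _ _ _ q1 q2 r1 r2) => //.
- by rewrite !ltW.
- by rewrite u1 addr_ge0 // ltW.
- by rewrite u2 addr_ge0 // ltW.
Qed.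

(** For such [n] the segment from the lowest to the highest point would cross level 0 beyond 2,
    against [crossing_lt]. *)
Lemma wide_gap_contains2 : 3 <= n -> k 2 0.
Proof.
move=> n3; apply: contrapT => k20; have h1 := be13; have h2 := beal; have h3 := albe.
have := crossing_lt k20; have /andP[xt1 _] := xt_strip; have /andP[e0 e1] := eta01.
have xt0 : 3 * (1 + be) <= xt by apply: le_trans xt1; apply: ler_wpM2r; lra.
have : (1 + al) * (3 * (1 + be)) <= (1 + al) * xt by apply: ler_wpM2l; lra.
have : 0 <= (1 + be) * eta by rewrite mulr_ge0 //; lra.
have : 0 <= al * (be - 1 / 3) by rewrite mulr_ge0 //; lra.
by lra.
Qed.
End ZFrame.

(** * Normalising the body by shears, reflections and recentring *)

Section ZRow.
Variable R : realType.
Implicit Types (k : R -> R -> Prop) (p q r s : int).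

(* If the body contains (2,0), recentring at (1,0) and shearing replaces [m] by [m - 2]. *)
Lemma z_frame (m : nat) : forall k al be xt eta, cvx R k -> k 0 0 -> k 1 0 ->
  k xt (1 + be) -> (forall x y, k x y -> y <= 1 + be) ->
  k eta (- (1 + al)) -> (forall x y, k x y -> - (1 + al) <= y) ->
  (forall x, k x 1 -> m%:R < x < m%:R + 1) -> (forall x, k x (-1) -> 0 < x < 1) ->
  1 / 3 < be -> be <= al -> 4 / 3 < al + be -> 7 * al < 6 + 3 * be -> narrow R k (10 / 3).
Proof.
elim/ltn_ind: m => m IH k al be xt eta cv k00 k10 kT top kB bot l1 lN1 h1 h2 h3 h4.
case: m => [|[|m]] in IH l1 *.
- exists 1, 0; split; first by case.
  move=> x y x' y' h h'; rewrite mul1r mul0r addr0.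
  by apply: (width_gap0 _ _ 0 al be xt eta cv k00 k10 kT kB l1 lN1 h1 h2 h3 _ _ _ _ _ h h').
- exists 1, 0; split; first by case.
  move=> x y x' y' h h'; rewrite mul1r mul0r addr0.
  by apply: (width_gap1 _ _ 1 al be xt eta cv k00 k10 kT top kB l1 lN1 h1 h2 h3 h4 _ _ _ _ _ h h').
have [k20|k20] := pselect (k 2 0).
  have un : unimodular 1 1 0 1 by left.
  have e X Y : tr R 1 1 0 1 1 0 k X Y = k (X + Y + 1) Y.
    by rewrite /tr !mul1r mul0r add0r addr0.
  apply: (tr_narrow _ _ _ _ _ 1 0 _ _ un).
  apply: (IH m _ _ al be (xt - 1 - (1 + be)) (eta - 1 + (1 + al))) => //.
  - exact: tr_cvx.
  - by rewrite e !add0r.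
  - by rewrite e addr0.
  - by rewrite e; move: kT; congr (k _ _); ring.
  - by move=> x y; rewrite e => /top.
  - by rewrite e; move: kB; congr (k _ _); ring.
  - by move=> x y; rewrite e => /bot.
  - by move=> x; rewrite e => /l1; rewrite -!natr1 => /andP[? ?]; apply/andP; split; lra.
  - by move=> x; rewrite e addrNK; exact: lN1.
case: m => [|m] in IH l1 *.
  exists 1, (-1); split; first by case.
  move=> x y x' y' h h'; rewrite rmorphN1 mul1r mulN1r opprB addrCA addrA.
  have := width_gap2 _ _ 2 al be xt eta cv k00 k10 kT top kB bot l1 lN1 h1 h2 h3 h4 _ _ _ _ erefl k20 h h'.
  by congr (_ <= _); ring.
case: k20; apply: (wide_gap_contains2 _ _ m.+3%:R al be xt eta cv k00 k10 kT kB l1 lN1 h1 h2 h3).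
by rewrite ler_nat.
Qed.

Lemma unit_gap k y x : cvx R k -> (forall j : int, ~ k j%:~R y) -> k x y ->
  forall X, k X y -> (Num.floor x)%:~R < X < (Num.floor x)%:~R + 1.
Proof.
move=> cv nj h X hX; have /andP[f1 f2] := floor_itv x; move: f2; rewrite intrD => f2.
apply/andP; split; rewrite ltNge; apply/negP => hx.
  by apply: (nj (Num.floor x)); apply: (cvx_hor _ _ _ _ _ _ cv hX h).
by apply: (nj (Num.floor x + 1)); rewrite intrD; apply: (cvx_hor _ _ _ _ _ _ cv h hX (ltW f2) hx).
Qed.

Lemma z_core_down k xt b xb a : cvx R k -> k 0 0 -> k 1 0 ->
  (forall j : int, ~ k j%:~R 1) -> (forall j : int, ~ k j%:~R (-1)) ->
  k xt b -> (forall x y, k x y -> y <= b) ->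
  k xb (- a) -> (forall x y, k x y -> - a <= y) -> b <= a -> 10 / 3 < a + b -> narrow R k (10 / 3).
Proof.
move=> cv k00 k10 n1 n2 kT top kB bot ba ab.
have b0 : 0 <= b by exact: top k00.
have [x0 hx0] : exists x, k x (-1).
  have bb : - a <= (-1 : R) <= 0 by apply/andP; split; lra.
  have cc := cvx_between _ _ _ _ _ _ (-1) cv kB k00 bb ltac:(idtac; lra).
  by eexists; exact: cc.
pose m := Num.floor x0; have gap := unit_gap _ _ _ cv n2 hx0.
(* A shear fixing level 0 moves the section at level -1 into [(0, 1)]. *)
wlog m0 : k xt xb x0 cv k00 k10 n1 n2 kT top kB bot hx0 @m gap / m = 0.
  move=> wl; have un : unimodular 1 (- m) 0 1 by left; ring.
  have e X Y : tr R 1 (- m) 0 1 0 0 k X Y = k (X - m%:~R * Y) Y.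
    by rewrite /tr rmorphN !mul1r mul0r add0r !addr0 mulNr.
  apply: (tr_narrow _ _ _ _ _ 0 0 _ _ un).
  have fl : Num.floor (x0 - m%:~R) = 0.
    by apply: floor_def; rewrite subr_ge0 ltrBlDl -intrD; exact: floor_itv.
  apply: (wl _ (xt + m%:~R * b) (xb - m%:~R * a) (x0 - m%:~R)).
  - exact: tr_cvx.
  - by rewrite e mulr0 subr0.
  - by rewrite e mulr0 subr0.
  - by move=> j; rewrite e mulr1 -rmorphB; exact: n1.
  - by move=> j; rewrite e mulrN1 opprK -rmorphD; exact: n2.
  - by rewrite e addrK.
  - by move=> x y; rewrite e => /top.
  - by rewrite e; move: kB; congr (k _ _); ring.
  - by move=> x y; rewrite e => /bot.
  - by rewrite e mulrN1 opprK subrK.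
  - move=> X; rewrite e fl => /gap.
    by rewrite mulrN1 opprK => /andP[? ?]; apply/andP; split; rewrite /m; lra.
  - exact: fl.
rewrite -/m m0 add0r in gap.
pose al := a - 1; pose be := b - 1.
have ea : a = 1 + al by rewrite /al; ring.
have eb : b = 1 + be by rewrite /be; ring.
clearbody al be; subst a b; clear m m0.
(* With a deep lowest point the two horizontal overhangs sum to at most [(2 + be) / al], and this
   condition says that one more unit still gives at most 10/3. In the other case [1 / 3 < be]
   follows from the total height. *)
have [cr|cr] := lerP (6 + 3 * be) (7 * al).
  exists 1, 0; split; first by case.
  move=> x y x' y' h h'; rewrite mul1r mul0r addr0.
  have al0 : 0 < al by lra.
  have strip X Y : k X Y -> Y <= -1 -> 0 <= X <= 1.
    exact: (below_strip _ _ cv k00 k10 gap).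
  have lB : - (1 + al) <= -1 by lra.
  have /andP[e0 e1] := strip _ _ kB lB.
  have wb X Y : k X Y -> -1 <= Y -> al * - X <= (1 + Y) * xb /\ al * (X - 1) <= (1 + Y) * (1 - xb).
    move=> hX hY.
    have y0 : 0 < Y - - (1 + al) by lra.
    have bb : - (1 + al) <= -1 <= Y by apply/andP; split; lra.
    have cc := cvx_between _ _ _ _ _ _ (-1) cv kB hX bb ltac:(idtac; lra).
    have /andP[] := gap _ cc.
    by rewrite ltr_pdivlMr // ltr_pdivrMr // => l1 l2; split; lra.
  have all X Y : k X Y -> al * - X <= (2 + be) * xb /\ al * (X - 1) <= (2 + be) * (1 - xb).
    move=> hX; have [y1|y1] := lerP Y (-1).
      have /andP[X0 X1] := strip _ _ hX y1.
      have : 0 <= (2 + be) * xb by apply: mulr_ge0; lra.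
      have : 0 <= (2 + be) * (1 - xb) by apply: mulr_ge0; lra.
      have : 0 <= al * X by apply: mulr_ge0; lra.
      have : 0 <= al * (1 - X) by apply: mulr_ge0; lra.
      by split; lra.
    have [w1 w2] := wb _ _ hX (ltW y1); have tY := top _ _ hX.
    have : 0 <= (1 + be - Y) * xb by apply: mulr_ge0; lra.
    have : 0 <= (1 + be - Y) * (1 - xb) by apply: mulr_ge0; lra.
    by split; lra.
  have [_ q1] := all _ _ h; have [q2 _] := all _ _ h'.
  have : al * (x - x') <= al * (10 / 3) by lra.
  by rewrite ler_pM2l.
have be3 : 1 / 3 < be by lra.
have [x1 hx1] : exists x, k x 1.
  have bb : 0 <= (1 : R) <= 1 + be by apply/andP; split; lra.
  have cc := cvx_between _ _ _ _ _ _ 1 cv k00 kT bb ltac:(idtac; lra).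
  by eexists; exact: cc.
have gap1 := unit_gap _ _ _ cv n1 hx1; move: (Num.floor x1) gap1 => n gap1.
have [n0|n0] := lerP 0 n.
  apply: (z_frame `|n|%N k al be xt xb) => //; try lra.
  have -> : `|n|%N%:R = n%:~R :> R by rewrite pmulrn gez0_abs.
  exact: gap1.
(* The reflection [x -> 1 - x] exchanges [(0, 0)] and [(1, 0)], preserves the gap [(0, 1)] at level
   -1 and turns [n] into [- n]. *)
have un : unimodular (-1) 0 0 1 by right.
have e X Y : tr R (-1) 0 0 1 1 0 k X Y = k (1 - X) Y.
  by rewrite /tr rmorphN1 mulN1r mul0r !addr0 mul0r mul1r add0r addrC.
apply: (tr_narrow _ _ _ _ _ 1 0 _ _ un).
apply: (z_frame `|n|%N _ al be (1 - xt) (1 - xb)) => //; try lra.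
- exact: tr_cvx.
- by rewrite e subr0.
- by rewrite e subrr.
- by rewrite e subKr.
- by move=> x y; rewrite e => /top.
- by rewrite e subKr.
- by move=> x y; rewrite e => /bot.
- move=> x; rewrite e => /gap1.
  have -> : `|n|%N%:R = - n%:~R :> R by rewrite pmulrn ltz0_abs // rmorphN.
  by move=> /andP[? ?]; apply/andP; split; lra.
- by move=> x; rewrite e => /gap /andP[? ?]; apply/andP; split; lra.
Qed.

Lemma z_core k : cvx R k -> attains R k -> k 0 0 -> k 1 0 ->
  (forall j : int, ~ k j%:~R 1) -> (forall j : int, ~ k j%:~R (-1)) -> narrow R k (10 / 3).
Proof.
move=> cv at_ k00 k10 n1 n2.
have [|xT [yT [kT topT]]] := at_ 0 1; first by exists 0, 0.
have [|xB [yB [kB botB]]] := at_ 0 (-1); first by exists 0, 0.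
have {}topT x y : k x y -> y <= yT by move/topT; lra.
have {}botB x y : k x y -> yB <= y by move/botB; lra.
have [small|tall] := lerP (yT - yB) (10 / 3).
  exists 0, 1; split; first by case.
  by move=> x y x' y' /topT hT /botB hB; lra.
have [ab|ab] := lerP yT (- yB).
  apply: (z_core_down k xT yT xB (- yB)); rewrite ?opprK //; try lra.
have un : unimodular 1 0 0 (-1) by right.
have e X Y : tr R 1 0 0 (-1) 0 0 k X Y = k X (- Y).
  by rewrite /tr rmorphN1 mulN1r !mul0r !addr0 mul1r add0r.
apply: (tr_narrow _ _ _ _ _ 0 0 _ _ un).
apply: (z_core_down _ xB (- yB) xT yT).
- exact: tr_cvx.
- by rewrite e oppr0.
- by rewrite e oppr0.
- by move=> j; rewrite e; exact: n2.
- by move=> j; rewrite e opprK; exact: n1.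
- by rewrite e opprK.
- by move=> x y; rewrite e => /botB; lra.
- by rewrite e opprK.
- by move=> x y; rewrite e => /topT; lra.
- by lra.
- by lra.
Qed.
End ZRow.

(** * Adding lattice points *)

Section ZEnlarge.
Variable R : realType.
Implicit Types (k : R -> R -> Prop) (p q r s : int).

Definition cone k (a b : R) : R -> R -> Prop := fun X Y => exists t x y,
  [/\ 0 <= t, t <= 1, k x y, X = (1 - t) * x + t * a & Y = (1 - t) * y + t * b].

Lemma cone_sub k a b x y : k x y -> cone k a b x y.
Proof. by move=> h; exists 0, x, y; split=> //; rewrite ?ler01 // subr0 mul1r mul0r addr0. Qed.

Lemma cone_apex k a b x y : k x y -> cone k a b a b.
Proof. by move=> h; exists 1, x, y; split=> //; rewrite ?ler01 // subrr mul1r mul0r add0r. Qed.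

Lemma cone_cvx k a b : cvx R k -> cvx R (cone k a b).
Proof.
move=> cv c d _ _ _ _ X Y c0 d0 cd [t [x [y [t0 t1 h -> ->]]]] [t' [x' [y' [t0' t1' h' -> ->]]]] eX eY.
pose w := c + d; pose T := (c * t + d * t') / w.
have w0 : w != 0 by rewrite gt_eqF.
have wT : w * T = c * t + d * t' by rewrite mulrC divfK.
have m1 : 0 <= c * (1 - t) by rewrite mulr_ge0 // subr_ge0.
have m2 : 0 <= d * (1 - t') by rewrite mulr_ge0 // subr_ge0.
have m3 : 0 <= c * t by rewrite mulr_ge0.
have m4 : 0 <= d * t' by rewrite mulr_ge0.
have T0 : 0 <= T by rewrite divr_ge0 ?addr_ge0.
have T1 : T <= 1 by rewrite ler_pdivrMr // mul1r /w; lra.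
(* At [T = 1] only the apex carries weight, and the base point [x2], [y2] below would have
   denominator 0. *)
have [e|ne] := eqVneq T 1.
  have z1 : c * (1 - t) = 0 by rewrite e mulr1 /w in wT; lra.
  have z2 : d * (1 - t') = 0 by rewrite e mulr1 /w in wT; lra.
  have ap : cone k a b a b by exact: cone_apex h.
  suff [-> ->] : X = a /\ Y = b by [].
  split; apply: (mulfI w0).
    by rewrite eX !mulrDr !mulrA z1 z2 !mul0r !add0r -mulrDl -wT e mulr1.
  by rewrite eY !mulrDr !mulrA z1 z2 !mul0r !add0r -mulrDl -wT e mulr1.
have T1' : 1 - T != 0 by rewrite subr_eq0 eq_sym.
have wT1 : c * (1 - t) + d * (1 - t') = w * (1 - T) by rewrite [RHS]mulrBr wT /w; ring.
pose x2 := (c * (1 - t) * x + d * (1 - t') * x') / (w * (1 - T)).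
pose y2 := (c * (1 - t) * y + d * (1 - t') * y') / (w * (1 - T)).
have wn : w * (1 - T) != 0 by rewrite mulf_neq0.
exists T, x2, y2; split=> //.
- apply: (cv (c * (1 - t)) (d * (1 - t')) _ _ _ _ _ _ m1 m2 _ h h').
  + by rewrite wT1 mulr_gt0 // subr_gt0 lt_neqAle ne.
  + by rewrite wT1 mulrC divfK.
  + by rewrite wT1 mulrC divfK.
- apply: (mulfI w0); rewrite eX.
  have -> : w * ((1 - T) * x2 + T * a) = x2 * (w * (1 - T)) + (w * T) * a by ring.
  by rewrite wT divfK //; ring.
- apply: (mulfI w0); rewrite eY.
  have -> : w * ((1 - T) * y2 + T * b) = y2 * (w * (1 - T)) + (w * T) * b by ring.
  by rewrite wT divfK //; ring.
Qed.

Lemma cone_attains k a b : attains R k -> (exists x y, k x y) -> attains R (cone k a b).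
Proof.
move=> at_ ne c d _; have [x [y [h m]]] := at_ c d ne.
have e t u v : c * ((1 - t) * u + t * a) + d * ((1 - t) * v + t * b) =
   (1 - t) * (c * u + d * v) + t * (c * a + d * b) by ring.
have [le|le] := lerP (c * a + d * b) (c * x + d * y).
  exists x, y; split; first exact: cone_sub.
  move=> _ _ [t [u [v [t0 t1 /m h' -> ->]]]]; rewrite e.
  have : (1 - t) * (c * u + d * v) <= (1 - t) * (c * x + d * y) by rewrite ler_wpM2l // subr_ge0.
  have : t * (c * a + d * b) <= t * (c * x + d * y) by rewrite ler_wpM2l.
  by lra.
exists a, b; split; first exact: cone_apex h.
move=> _ _ [t [u [v [t0 t1 /m h' -> ->]]]]; rewrite e.
have : (1 - t) * (c * u + d * v) <= (1 - t) * (c * a + d * b).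
  by rewrite ler_wpM2l ?subr_ge0 // (le_trans h') // ltW.
by lra.
Qed.

Lemma cone_mono k a b a' b' X Y : cvx R k -> cone k a b a' b' -> cone k a' b' X Y -> cone k a b X Y.
Proof.
move=> cv h [t [x [y [t0 t1 h' -> ->]]]].
have t1' : 0 <= 1 - t by rewrite subr_ge0.
have e : 1 - t + t = 1 by rewrite subrK.
apply: (cone_cvx _ _ _ cv (1 - t) t _ _ _ _ _ _ t1' t0 _ (cone_sub _ a b _ _ h') h);
  by rewrite e ?mul1r ?ltr01.
Qed.

(** The anti-exchange property of convex hulls; it makes the descent in [enlarge] strict. *)
Lemma cone_antisym k a b a' b' : cvx R k -> ~ k a b -> (a', b') <> (a, b) ->
  cone k a b a' b' -> ~ cone k a' b' a b.
Proof.
move=> cv nk ne [t [x [y [t0 t1 h ea eb]]]] [s [x' [y' [s0 s1 h' ea' eb']]]].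
apply: nk.
have tn : t < 1.
  rewrite lt_neqAle t1 andbT; apply/eqP => e; apply: ne.
  by rewrite ea eb e subrr !mul0r !add0r !mul1r.
have c1 : 0 <= s * (1 - t) by rewrite mulr_ge0 // subr_ge0.
have c2 : 0 <= 1 - s by rewrite subr_ge0.
have st : s * t <= t by rewrite -[leRHS]mul1r ler_wpM2r.
apply: (cv (s * (1 - t)) (1 - s) _ _ _ _ _ _ c1 c2 _ h h').
- by lra.
- by move: ea'; rewrite ea => ea'; lra.
- by move: eb'; rewrite eb => eb'; lra.
Qed.

Definition lattice_pt k (z : int * int) := k z.1%:~R z.2%:~R.

Lemma attains_bounded k : attains R k -> (exists x y, k x y) ->
  exists N : nat, forall x y, k x y -> `|x| <= N%:R /\ `|y| <= N%:R.
Proof.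
move=> at_ ne.
have [x1 [y1 [_ m1]]] := at_ 1 0 ne; have [x2 [y2 [_ m2]]] := at_ (-1) 0 ne.
have [x3 [y3 [_ m3]]] := at_ 0 1 ne; have [x4 [y4 [_ m4]]] := at_ 0 (-1) ne.
pose B := `|x1| + `|x2| + `|y3| + `|y4|.
exists (Num.Def.archi_bound B) => x y h.
have b0 : B <= (Num.Def.archi_bound B)%:R by apply/ltW/archi_boundP; rewrite !addr_ge0.
have a1 := m1 _ _ h; have a2 := m2 _ _ h; have a3 := m3 _ _ h; have a4 := m4 _ _ h.
have n1 := ler_norm x1; have n2 := ler_norm (- x2); have n3 := ler_norm y3; have n4 := ler_norm (- y4).
rewrite !normrN in n2 n4.
have p1 := normr_ge0 x1; have p2 := normr_ge0 x2; have p3 := normr_ge0 y3; have p4 := normr_ge0 y4.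
by rewrite /B in b0; split; rewrite ler_norml; apply/andP; split; lra.
Qed.

Lemma enlarge k : cvx R k -> attains R k -> (exists x y, k x y) ->
  exists q : int * int, ~ lattice_pt k q /\
    forall z, lattice_pt (cone k q.1%:~R q.2%:~R) z -> lattice_pt k z \/ z = q.
Proof.
move=> cv at_ ne.
have [N hN] := attains_bounded _ at_ ne.
pose C (q : int * int) := lattice_pt (cone k q.1%:~R q.2%:~R).
(* A lattice point outside the body, since [N] bounds all abscissae. *)
pose q0 : int * int := (N.+1%:Z, 0).
have [M hM] : exists M : nat, forall z, C q0 z -> `|z.1|%R <= M%:Z /\ `|z.2|%R <= M%:Z.
  have [M hM] := attains_bounded _ (cone_attains _ q0.1%:~R q0.2%:~R at_ ne)
     ltac:(idtac; have [x [y h]] := ne; exists x, y; exact: cone_sub h).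
  exists M => z /hM; rewrite -!intr_norm -!(ler_int R) => -[h1 h2].
  by split; [exact: h1 | exact: h2].
(* A finite box indexes all lattice points of the first cone, so that smaller cones can be compared
   by cardinality. *)
pose pt (i : 'I_(2 * M).+1 * 'I_(2 * M).+1) : int * int := (i.1%:Z - M%:Z, i.2%:Z - M%:Z).
have pt_surj z : C q0 z -> exists i, pt i = z.
  move=> /hM [h1 h2].
  have aux (a : int) : `|a| <= M%:Z -> exists i : 'I_(2 * M).+1, i%:Z - M%:Z = a.
    rewrite ler_norml => /andP[l1 l2].
    have [m e] : exists m : nat, m%:Z = a + M%:Z by exists (absz (a + M%:Z)); rewrite gez0_abs //; lra.
    have lt : (m < (2 * M).+1)%N by rewrite -ltz_nat e -addn1 PoszD PoszM; lra.
    by exists (Ordinal lt); rewrite /= e addrK.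
  have [i hi] := aux _ h1; have [j hj] := aux _ h2.
  by exists (i, j); rewrite /pt hi hj; case: (z).
pose S (q : int * int) := [set i | `[< C q (pt i) >]]%SET.
have main : forall n (q : int * int), (#|S q| < n)%N -> C q0 q -> ~ lattice_pt k q ->
   exists q : int * int, ~ lattice_pt k q /\ forall z, C q z -> lattice_pt k z \/ z = q.
  (* Replacing [q] by another new lattice point of its cone loses [q], hence lattice points. *)
  elim=> // n IH q lt cq nk.
  have [[z [h1 h2 h3]]|no] := pselect (exists z, [/\ C q z, ~ lattice_pt k z & z <> q]); last first.
    exists q; split=> // z hz; apply: contrapT => /not_orP[a b]; apply: no; by exists z.
  have cz : C q0 z by exact: (cone_mono _ _ _ _ _ _ _ cv cq h1).
  apply: (IH z) => //; rewrite ltnS in lt; apply: leq_trans lt; apply: proper_card.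
  apply/properP; split.
    by apply/fintype.subsetP => i; rewrite !inE => hi; exact: (cone_mono _ _ _ _ _ _ _ cv h1 hi).
  have [i ei] := pt_surj _ cq; exists i.
    by rewrite !inE ei; have [x [y h]] := ne; exact: cone_apex h.
  rewrite inE ei; apply/asboolP; apply: (cone_antisym _ _ _ _ _ cv nk) => //.
  move=> [] /eqP e1 /eqP e2; apply: h3; move: e1 e2; rewrite !eqr_int => /eqP e1 /eqP e2.
  by case: (z) (q) e1 e2 => ? ? [? ?] /= -> ->.
apply: (main _ q0 (ltnSn _)).
  by have [x [y h]] := ne; exact: cone_apex h.
move=> /hN [+ _]; rewrite /q0 /= -[_%:~R]/(N.+1%:R) normr_nat ler_nat ltnn //.
Qed.

Definition lattice_triangle_free k := forall a b p q r s : int, unimodular p q r s ->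
  k a%:~R b%:~R -> k (a%:~R + p%:~R) (b%:~R + r%:~R) -> k (a%:~R + q%:~R) (b%:~R + s%:~R) -> False.

(** A unimodular triangle has three distinct vertices. *)
Lemma few_lattice_triangle_free k z1 z2 : (forall z, lattice_pt k z -> z = z1 \/ z = z2) ->
  lattice_triangle_free k.
Proof.
move=> h a b p q r s u h1 h2 h3; rewrite -!intrD in h2 h3.
have e1 := h (a, b) h1; have e2 := h (a + p, b + r) h2; have e3 := h (a + q, b + s) h3.
have n1 : (a, b) <> (a + p, b + r).
  move=> [/esym/eqP]; rewrite addrC -subr_eq0 addrK => /eqP e /esym/eqP.
  rewrite addrC -subr_eq0 addrK => /eqP e'; move: u; rewrite /unimodular e e'.
  by rewrite mul0r mulr0 subr0 => -[].
have n2 : (a, b) <> (a + q, b + s).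
  move=> [/esym/eqP]; rewrite addrC -subr_eq0 addrK => /eqP e /esym/eqP.
  rewrite addrC -subr_eq0 addrK => /eqP e'; move: u; rewrite /unimodular e e'.
  by rewrite mul0r mulr0 subr0 => -[].
have n3 : (a + p, b + r) <> (a + q, b + s).
  move=> [/addrI e /addrI e']; move: u; rewrite /unimodular e e' mulrC subrr.
  by case.
move: (a, b) (a + p, b + r) (a + q, b + s) n1 n2 n3 e1 e2 e3 => A B C n1 n2 n3.
by move=> [e1|e1] [e2|e2] [e3|e3]; subst.
Qed.

(** The primitive vector in the direction [z2 - z1], attached to [z1], ends on the segment and hence
    in the body; coordinates are chosen in which it becomes [(1, 0)]. *)
Lemma lattice_pair_narrow k (z1 z2 : int * int) : cvx R k -> attains R k -> lattice_triangle_free k ->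
  lattice_pt k z1 -> lattice_pt k z2 -> z1 <> z2 -> narrow R k (10 / 3).
Proof.
move: z1 z2 => [x1 y1] [x2 y2] cv at_ tf h1 h2 ne; rewrite /lattice_pt /= in h1 h2.
have nz : ~ (x2 - x1 = 0 /\ y2 - y1 = 0).
  by move=> [/eqP + /eqP]; rewrite !subr_eq0 => /eqP e1 /eqP e2; apply: ne; rewrite e1 e2.
have [g [u [v [a [b [g0 eu ev hab]]]]]] := primitive_part _ _ nz.
have un : unimodular u (- b) v a by left; rewrite -hab; ring.
have e X Y : tr R u (- b) v a x1%:~R y1%:~R k X Y =
    k (u%:~R * X - b%:~R * Y + x1%:~R) (v%:~R * X + a%:~R * Y + y1%:~R).
  by rewrite /tr rmorphN mulNr.
have k00 : tr R u (- b) v a x1%:~R y1%:~R k 0 0 by rewrite e !mulr0 subr0 addr0 !add0r.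
have g1 : 1 <= g%:~R :> R by rewrite ler1z -gtz0_ge1.
have k10 : tr R u (- b) v a x1%:~R y1%:~R k 1 0.
  rewrite e !mulr0 subr0 addr0 !mulr1.
  have eu' : x2%:~R - x1%:~R = g%:~R * u%:~R :> R by rewrite -intrM -eu rmorphB.
  have ev' : y2%:~R - y1%:~R = g%:~R * v%:~R :> R by rewrite -intrM -ev rmorphB.
  apply: (cv (g%:~R - 1) 1 _ _ _ _ _ _ _ _ _ h1 h2); lra.
(* Any lattice point at level 1 or -1 forms a unimodular triangle with [(0, 0)] and [(1, 0)]. *)
have no (j sg : int) : sg * sg = 1 -> ~ tr R u (- b) v a x1%:~R y1%:~R k j%:~R sg%:~R.
  move=> sg2 hj; rewrite e in hj; rewrite e !mulr0 !mulr1 subr0 addr0 in k10.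
  have un2 : unimodular 1 j 0 sg.
    rewrite /unimodular mul1r mulr0 subr0.
    have : (sg - 1) * (sg + 1) = 0 by rewrite -subr_sqr_1 expr2 sg2 subrr.
    by move/eqP; rewrite mulf_eq0 subr_eq0 addr_eq0 => /orP[/eqP|/eqP]; tauto.
  have un3 := unimodular_mul _ _ _ _ _ _ _ _ un un2.
  apply: (tf x1 y1 _ _ _ _ un3 h1); rewrite !intrD !intrM.
    by move: k10; congr (k _ _); rewrite !mulr1 !mulr0 !addr0 addrC.
  by move: hj; congr (k _ _); rewrite ?rmorphN; ring.
apply: (tr_narrow _ _ _ _ _ x1%:~R y1%:~R _ _ un); apply: z_core => //.
- exact: tr_cvx.
- exact: tr_attains.
- by move=> j; apply: (no j 1).
- by move=> j; apply: (no j (-1)).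
Qed.

(** Each enlargement adds exactly one lattice point; with two in all no triangle fits, and the width
    bound descends to the smaller body. *)
Lemma lattice_narrow k : cvx R k -> attains R k -> (exists x y, k x y) -> lattice_triangle_free k ->
  narrow R k (10 / 3).
Proof.
move=> cv at_ ne tf.
have [[z1 [z2 [h1 h2 h12]]]|atmost1] := pselect (exists z1 z2, [/\ lattice_pt k z1, lattice_pt k z2 & z1 <> z2]).
  exact: (lattice_pair_narrow k z1 z2).
have ext (q : int * int) : exists x y, cone k q.1%:~R q.2%:~R x y by have [x [y h]] := ne; exists x, y; exact: cone_sub.
have [q [nq hq]] := enlarge k cv at_ ne.
pose k1 := cone k q.1%:~R q.2%:~R.
have cv1 : cvx R k1 by exact: cone_cvx.
have at1 : attains R k1 by exact: cone_attains.
have ne1 : exists x y, k1 x y by have [x [y h]] := ne; exists x, y; exact: cone_sub.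
have q1 : lattice_pt k1 q by have [x [y h]] := ne; exact: cone_apex h.
apply: (@narrow_sub R k k1); first by move=> x y; exact: cone_sub.
have [[z hz]|none] := pselect (exists z, lattice_pt k z).
  apply: (lattice_pair_narrow k1 z q) => //; last by move=> e; apply: nq; rewrite -e.
    apply: (few_lattice_triangle_free _ z q) => w /hq[hw|]; last by right.
    by left; apply: contrapT => wz; apply: atmost1; exists w, z.
  exact: cone_sub.
have [q' [nq' hq']] := enlarge k1 cv1 at1 ne1.
have q2 : lattice_pt (cone k1 q'.1%:~R q'.2%:~R) q' by have [x [y h]] := ne1; exact: cone_apex h.
apply: (@narrow_sub R k1 (cone k1 q'.1%:~R q'.2%:~R)); first by move=> x y; exact: cone_sub.
apply: (lattice_pair_narrow _ q q') => //.
- exact: cone_cvx.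
- exact: cone_attains.
- apply: (few_lattice_triangle_free _ q q') => w /hq'[/hq[hw|->]|]; [|by left|by right].
  by case: none; exists w.
- exact: cone_sub.
- by move=> e; apply: nq'; rewrite -e.
Qed.
End ZEnlarge.

(** * Convex bodies of the plane *)

Section Glue.
Variable R : realType.
Import numFieldNormedType.Exports.
Local Open Scope classical_set_scope.

Definition rv (x y : R) : pt R := \row_(i < 2) if i == ord0 then x else y.

Definition planar (K : set (pt R)) : R -> R -> Prop := fun x y => K (rv x y).

Local Notation i0 := (ord0 : 'I_2).
Local Notation i1 := (lift ord0 ord0 : 'I_2).

Lemma rv0 x y : rv x y 0 i0 = x. Proof. by rewrite mxE. Qed.
Lemma rv1 x y : rv x y 0 i1 = y. Proof. by rewrite mxE. Qed.

Lemma rv_eta (z : pt R) : z = rv (z 0 i0) (z 0 i1).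
Proof.
apply/rowP => j; rewrite mxE; case: (unliftP ord0 j) => [j' ->|->]; last by rewrite eqxx.
by rewrite (ord1 j').
Qed.

Lemma rvD x y x' y' : rv x y + rv x' y' = rv (x + x') (y + y').
Proof. by rewrite [LHS]rv_eta !mxE. Qed.

Lemma rvZ c x y : c *: rv x y = rv (c * x) (c * y).
Proof. by rewrite [LHS]rv_eta !mxE. Qed.

Lemma lin_rv (u : 'rV[int]_2) x y : lin u (rv x y) = (u 0 i0)%:~R * x + (u 0 i1)%:~R * y.
Proof. by rewrite /lin !big_ord_recl big_ord0 addr0 rv0 rv1. Qed.

Lemma planar_cvx K : convex2 K -> cvx R (planar K).
Proof.
move=> cK a b x y x' y' X Y a0 b0 ab h h' eX eY.
have n0 : a + b != 0 by rewrite gt_eqF.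
have t0 : 0 <= a / (a + b) by rewrite divr_ge0 // addr_ge0.
have t1 : a / (a + b) <= 1 by rewrite ler_pdivrMr // mul1r lerDl.
have := cK _ _ _ h h' t0 t1.
have -> : 1 - a / (a + b) = b / (a + b) by field.
rewrite !rvZ rvD /planar; congr (K (rv _ _)); apply: (mulfI n0).
  by rewrite eX; field.
by rewrite eY; field.
Qed.

Lemma rv_lin_continuous (c d : R) : continuous (fun z : pt R => c * z 0 i0 + d * z 0 i1).
Proof.
move=> z; have h0 := @coord_continuous R 1 2 0 i0 z; have h1 := @coord_continuous R 1 2 0 i1 z.
exact: (cvgD (cvgM (cvg_cst c) h0) (cvgM (cvg_cst d) h1)).
Qed.

(** The points [z] with both [z] and [z + (u, v)] in [K] form the intersection of [K] with a
    translate, a compact set on which linear functions attain their maxima. *)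
Lemma planar_body K : convex_body K -> body R (planar K).
Proof.
move=> [_ [cK vK]]; split; first exact: planar_cvx.
move=> u v c d [x0 [y0 [h0 h0']]].
pose S := K `&` (fun z : pt R => z + rv u v) @^-1` K.
have cS : compact S.
  apply: compact_closedI => //.
  have clK : closed K by apply: compact_closed => //; exact: norm_hausdorff.
  have ct : continuous (fun z : pt R => z + rv u v).
    by move=> z; exact: (@cvgD R 'rV[R]_2 _ (nbhs z) _ id (fun=> rv u v) z (rv u v) (@cvg_id _ (nbhs z)) (cvg_cst (rv u v))).
  by move/continuous_closedP: ct; exact.
have [|z /set_mem [z1 z2] mz] := compact_EVT_max (f := fun z : pt R => c * z 0 i0 + d * z 0 i1) _ cS
   (continuous_subspaceT (rv_lin_continuous c d)).
  by exists (rv x0 y0); split; [|rewrite /= rvD].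
exists (z 0 i0), (z 0 i1); split.
  by rewrite /planar -rv_eta -rvD -rv_eta.
move=> x y [h h']; have := mz (rv x y); rewrite rv0 rv1; apply; apply/mem_set.
by split; [|rewrite /= rvD].
Qed.

Lemma det2 (M : 'M[int]_2) : \det M = M i0 i0 * M i1 i1 - M i0 i1 * M i1 i0.
Proof.
rewrite (expand_det_row _ i0) !big_ord_recl big_ord0 addr0 /cofactor !det_mx11 !mxE /=.
rewrite expr0 mul1r expr1 mulN1r mulrN.
by congr (_ * M _ _ - _ * M _ _); apply/val_inj.
Qed.

Lemma GL2Z_det (M : 'M[int]_2) : GL2Z M <-> unimodular (M i0 i0) (M i0 i1) (M i1 i0) (M i1 i1).
Proof.
rewrite /unimodular -det2; split.
  move=> [N [h _]]; have [+ _] := mulmx1_unit h.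
  by rewrite unitmxE => /orP[/eqP|/eqP]; tauto.
move=> h; exists (invmx M).
have uM : M \in unitmx by rewrite unitmxE; case: h => ->.
by rewrite mulmxV // mulVmx.
Qed.

Lemma unimod_map_rv (M : 'M[int]_2) b x y : unimod_map M b (rv x y) =
  rv ((M i0 i0)%:~R * x + (M i0 i1)%:~R * y + b 0 i0) ((M i1 i0)%:~R * x + (M i1 i1)%:~R * y + b 0 i1).
Proof.
rewrite [LHS]rv_eta /unimod_map !mxE !big_ord_recl !big_ord0 !addr0 !mxE /=.
by rewrite ![_ * (M _ _)%:~R]mulrC.
Qed.

Lemma Delta2_rv a b c : 0 <= a -> 0 <= b -> 0 <= c -> a + b + c = 1 -> Delta2 (rv b c).
Proof.
move=> a0 b0 c0 s; exists a, b, c; split => //.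
by rewrite [RHS]rv_eta !mxE /= !mulr0 !mulr1 !add0r addr0.
Qed.

Lemma copy_triangle A (K : set (pt R)) : contains_copy A (@Delta2 R) K ->
  exists x y p q r s, [/\ unimodular p q r s,
    A = AZ -> exists a b : int, x = a%:~R /\ y = b%:~R,
    planar K x y, planar K (x + p%:~R) (y + r%:~R) & planar K (x + q%:~R) (y + s%:~R)].
Proof.
move=> [M [b [/GL2Z_det gM [tb sub]]]].
have im x y z : 0 <= x -> 0 <= y -> 0 <= z -> x + y + z = 1 -> K (unimod_map M b (rv y z)).
  by move=> *; apply: sub; exists (rv y z) => //; apply: (Delta2_rv x).
exists (b 0 i0), (b 0 i1), (M i0 i0), (M i0 i1), (M i1 i0), (M i1 i1); split => //.
- move=> eA; subst A; case: tb => c ->; exists (c 0 i0), (c 0 i1); by rewrite !mxE.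
- have := im 1 0 0; rewrite unimod_map_rv !mulr0 !add0r; apply => //; lra.
- by have := im 0 1 0; rewrite unimod_map_rv !mulr0 !mulr1 !addr0 ![_ + b _ _]addrC; apply => //; lra.
- by have := im 0 0 1; rewrite unimod_map_rv !mulr0 !mulr1 !add0r ![_ + b _ _]addrC; apply => //; lra.
Qed.

Lemma triangle_copy A (K : set (pt R)) x y p q r s : convex2 K -> unimodular p q r s ->
  (A = AZ -> exists a b : int, x = a%:~R /\ y = b%:~R) ->
  planar K x y -> planar K (x + p%:~R) (y + r%:~R) -> planar K (x + q%:~R) (y + s%:~R) ->
  contains_copy A (@Delta2 R) K.
Proof.
move=> /planar_cvx cv un tb h0 h1 h2.
pose M : 'M[int]_2 := \matrix_(i, j) if i == i0 then (if j == i0 then p else q)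
   else (if j == i0 then r else s).
exists M, (rv x y); split; first by apply/GL2Z_det; rewrite !mxE.
split.
  case: A tb => //= /(_ erefl) [a [b [-> ->]]].
  exists (\row_j if j == i0 then a else b); apply/rowP => j; rewrite !mxE.
  by case: ifP.
move=> _ [_ [a [b [c [a0 b0 c0 s1 ->]]]] <-].
have -> : a *: (0 : pt R) + b *: e R i0 + c *: e R i1 = rv b c.
  by rewrite [LHS]rv_eta !mxE /= !mulr0 !mulr1 !add0r addr0.
rewrite unimod_map_rv rv0 rv1 !mxE /=.
(* The homogeneous form of convexity needs positive total weight, so the vertex [b = c = 0] is
   treated apart. *)
have [bc|bc] := lerP (b + c) 0.
  have -> : b = 0 by lra. have -> : c = 0 by lra.
  by rewrite !mulr0 !add0r.
have h12 := cv b c _ _ _ _ ((b * (x + p%:~R) + c * (x + q%:~R)) / (b + c))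
  ((b * (y + r%:~R) + c * (y + s%:~R)) / (b + c)) b0 c0 bc h1 h2.
have n0 : b + c != 0 by rewrite gt_eqF.
have a1 : 0 < a + (b + c) by lra.
apply: (cv a (b + c) _ _ _ _ _ _ a0 (ltW bc) a1 h0 (h12 _ _)).
- by rewrite mulrC divfK.
- by rewrite mulrC divfK.
- by rewrite [(b + c) * _]mulrC divfK //; have -> : a = 1 - b - c by [lra]; ring.
- by rewrite [(b + c) * _]mulrC divfK //; have -> : a = 1 - b - c by [lra]; ring.
Qed.

Lemma narrow_width K c : narrow R (planar K) c -> (lattice_width K <= c%:E)%E.
Proof.
move=> [u [v [nz h]]]; pose w : 'rV[int]_2 := \row_j if j == i0 then u else v.
apply: (@le_trans _ _ (width_u K w)).
  apply: ereal_inf_lbound; exists w => //=.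
  apply/eqP => /rowP w0; apply: nz.
  by split; [have := w0 i0 | have := w0 i1]; rewrite !mxE.
apply: ge_ereal_sup => _ [x Kx [y Ky <-]]; rewrite lee_fin.
rewrite [x]rv_eta [y]rv_eta in Kx Ky *.
rewrite !lin_rv !mxE /= ler_norml; apply/andP; split.
  by have := h _ _ _ _ Ky Kx; lra.
by have := h _ _ _ _ Kx Ky; lra.
Qed.

Lemma Flt_le A c : (forall K, convex_body K -> ~ contains_copy A (@Delta2 R) K ->
  (lattice_width K <= c)%E) -> (Flt A (@Delta2 R) <= c)%E.
Proof. by move=> h; apply: ge_ereal_sup => _ [K [bK nK] <-]; exact: h. Qed.

Lemma planar_ne K : convex_body K -> exists x y, planar K x y.
Proof. by move=> [[z hz] _]; exists (z 0 i0), (z 0 i1); rewrite /planar -rv_eta. Qed.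

Lemma Flt_real_le : (Flt AR (@Delta2 R) <= 2%:E)%E.
Proof.
apply: Flt_le => K bK nK; apply/lee_addgt0Pr => ep ep0; rewrite -EFinD.
apply: narrow_width; apply: real_narrow => //; first exact: planar_body.
  move=> x y p q r s un h0 h1 h2; apply: nK.
  by apply: (triangle_copy AR K x y p q r s) => //; case: bK => _ [].
exact: planar_ne.
Qed.

Lemma Flt_int_le : (Flt AZ (@Delta2 R) <= (10 / 3)%:E)%E.
Proof.
apply: Flt_le => K bK nK; have bk := planar_body _ bK.
apply: narrow_width; apply: lattice_narrow => //; first by case: bk.
- exact: body_attains.
- exact: planar_ne.
move=> a b p q r s un h0 h1 h2; apply: nK.
apply: (triangle_copy AZ K a%:~R b%:~R p q r s) => //; first by case: bK => _ [].
by move=> _; exists a, b.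
Qed.

(** * Compact polygons, and lower bounds from nearly extremal bodies *)

Definition polygon (s : seq (R * R * R)) : set (pt R) :=
  [set z | forall h, h \in s -> h.1.1 * z 0 i0 + h.1.2 * z 0 i1 <= h.2].

Lemma polygon_convex_body s B : polygon s !=set0 ->
  (forall z, polygon s z -> `|z 0 i0| <= B /\ `|z 0 i1| <= B) -> convex_body (polygon s).
Proof.
move=> ne bd; split=> //; split.
  apply: bounded_closed_compact.
    exists B; split; first exact: num_real.
    move=> x Bx z /bd [z0 z1]; rewrite /Num.norm /= mx_normrE.
    apply: bigmax_le => [|[i j] _] /=.
      exact: le_trans (normr_ge0 _) (le_trans z0 (ltW Bx)).
    rewrite (ord1 i); apply: le_trans (ltW Bx).
    by case: (unliftP ord0 j) => [j' ->|-> //]; rewrite (ord1 j').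
  have -> : polygon s = \bigcap_(h in [set` s])
     (fun z : pt R => h.1.1 * z 0 i0 + h.1.2 * z 0 i1) @^-1` [set t | t <= h.2].
    by apply/seteqP; split=> z hz h; exact: hz.
  apply: closed_bigI => h _.
  by have /continuous_closedP := rv_lin_continuous h.1.1 h.1.2; apply; exact: closed_le.
move=> x y t hx hy t0 t1 h hs; rewrite !mxE.
have t1' : 0 <= 1 - t by rewrite subr_ge0.
have := ler_wpM2l t0 (hx _ hs); have := ler_wpM2l t1' (hy _ hs); lra.
Qed.

Lemma lattice_width_ge (K : set (pt R)) (c : R) :
  (forall u : 'rV[int]_2, u != 0 -> exists x y, [/\ K x, K y & c <= `|lin u x - lin u y|]) ->
  (c%:E <= lattice_width K)%E.
Proof.
move=> h; apply: le_ereal_inf_tmp => _ [u u0 <-].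
have [x [y [Kx Ky cxy]]] := h _ u0.
apply: (@le_trans _ _ (`|lin u x - lin u y|)%:E); first by rewrite lee_fin.
by apply: ereal_sup_ubound; exists x => //; exists y.
Qed.

Lemma Flt_ge A (c : R) : (forall ep : R, 0 < ep -> ep < 1 -> exists K,
    [/\ convex_body K, ~ contains_copy A (@Delta2 R) K & ((c * (1 - ep))%:E <= lattice_width K)%E]) ->
  0 < c -> (c%:E <= Flt A (@Delta2 R))%E.
Proof.
move=> h c0; apply/lee_subgt0Pr => e e0; rewrite -EFinB.
(* The first term keeps the loss [c * ep] below [e], the second keeps [ep] below 1. *)
pose ep := Num.min (e / c) (1 / 2).
have ep0 : 0 < ep by rewrite lt_min divr_gt0 //=; lra.
have ep1 : ep < 1 by rewrite gt_min; apply/orP; right; lra.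
have epe : c * ep <= e by rewrite mulrC -ler_pdivlMr // ge_min lexx.
have [K [bK nK wK]] := h _ ep0 ep1.
apply: (@le_trans _ _ (lattice_width K)); last by apply: ereal_sup_ubound; exists K.
by apply: le_trans wK; rewrite lee_fin; lra.
Qed.
End Glue.

(** * Extremal bodies *)

Section Extremal.
Variable R : realType.

Lemma polygonP (s : seq (R * R * R)) x y :
  polygon R s (rv R x y) <-> all (fun h => h.1.1 * x + h.1.2 * y <= h.2) s.
Proof.
split=> [h|/allP h] ; last by move=> a /h; rewrite rv0 rv1.
by apply/allP => a /h; rewrite rv0 rv1.
Qed.

Definition diamond (c : R) := polygon R [:: (1, 1, c); (1, -1, c); (-1, 1, c); (-1, -1, c)].

Lemma diamondP c x y : planar R (diamond c) x y <->
  [/\ x + y <= c, x - y <= c, y - x <= c & - x - y <= c].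
Proof.
rewrite /planar /diamond polygonP /= andbT; split.
  by move=> /and4P[*]; split; lra.
by move=> [*]; apply/and4P; split; lra.
Qed.

(** The diamond is a ball of the l1 norm, of diameter [2 * c < 2]. *)
Lemma diamond_edge c x y (p r : int) : c < 1 -> planar R (diamond c) x y ->
  planar R (diamond c) (x + p%:~R) (y + r%:~R) -> [/\ p + r < 2, p - r < 2, r - p < 2 & - p - r < 2].
Proof.
move=> c1 /diamondP[a1 a2 a3 a4] /diamondP[b1 b2 b3 b4].
by split; rewrite -(ltr_int R) ?(rmorphD, rmorphB, rmorphN) /=; lra.
Qed.

(** All edges of a copy would be integer vectors of l1 norm at most 1, but the difference of two
    linearly independent such vectors has l1 norm 2. *)
Lemma diamond_no_copy c : c < 1 -> ~ contains_copy AR (@Delta2 R) (diamond c).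
Proof.
move=> c1 /copy_triangle [x [y [p [q [r [s [un _ k0 k1 k2]]]]]]].
have [e1 e2 e3 e4] := diamond_edge _ _ _ _ _ c1 k0 k1.
have [f1 f2 f3 f4] := diamond_edge _ _ _ _ _ c1 k0 k2.
have [g1 g2 g3 g4] : [/\ (q - p) + (s - r) < 2, (q - p) - (s - r) < 2, (s - r) - (q - p) < 2
    & - (q - p) - (s - r) < 2].
  apply: (diamond_edge _ _ _ _ _ c1 k1); rewrite !rmorphB /=.
  by have -> : x + p%:~R + (q%:~R - p%:~R) = x + q%:~R by [ring];
     have -> : y + r%:~R + (s%:~R - r%:~R) = y + s%:~R by ring.
have hp : p = -1 \/ p = 0 \/ p = 1 by clear - e1 e2 e3 e4; lia.
have hr : r = -1 \/ r = 0 \/ r = 1 by clear - e1 e2 e3 e4; lia.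
rewrite /unimodular in un; clear - un e1 e2 e3 e4 f1 f2 f3 f4 g1 g2 g3 g4 hp hr.
by case: hp => [|[]] ?; subst p; case: hr => [|[]] ?; subst r; lia.
Qed.

Lemma int_norm_ge1 (u : int) : u <> 0 -> 1 <= `|u%:~R| :> R.
Proof. by move=> /eqP u0; rewrite -intr_norm ler1z -gtz0_ge1 normr_gt0. Qed.

Lemma diamond_width c : 0 < c -> ((2 * c)%:E <= lattice_width (diamond c))%E.
Proof.
move=> c0; apply: lattice_width_ge => u u0.
have inK x y : [/\ x + y <= c, x - y <= c, y - x <= c & - x - y <= c] -> diamond c (rv R x y).
  by move/diamondP.
have step (a : int) (x : R) : a <> 0 -> x = a%:~R * (2 * c) -> 2 * c <= `|x|.
  move=> /int_norm_ge1 a1 ->; rewrite normrM (ger0_norm (_ : 0 <= 2 * c)); last by lra.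
  by rewrite -[leLHS]mul1r ler_wpM2r //; lra.
have [e|/eqP ne] := eqVneq (u 0 ord0) 0.
  exists (rv R 0 c), (rv R 0 (- c)); split.
  - by apply: inK; split; lra.
  - by apply: inK; split; lra.
  apply: (step (u 0 (lift ord0 ord0))); last by rewrite !lin_rv; ring.
  move=> e1.
  move/eqP: u0; apply; apply/rowP => j; rewrite mxE.
  by case: (unliftP ord0 j) => [j' ->|->] //; rewrite (ord1 j').
exists (rv R c 0), (rv R (- c) 0); split.
- by apply: inK; split; lra.
- by apply: inK; split; lra.
by apply: (step (u 0 ord0)) => //; rewrite !lin_rv; ring.
Qed.

Lemma Flt_real_ge : (2%:E <= Flt AR (@Delta2 R))%E.
Proof.
apply: Flt_ge => // ep ep0 ep1; exists (diamond (1 - ep)); split.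
- apply: (@polygon_convex_body R _ 1).
    by exists (rv R 0 0); apply/diamondP; split; lra.
  move=> z; rewrite [z]rv_eta => /diamondP[*]; rewrite rv0 rv1 !ler_norml.
  by split; apply/andP; split; lra.
- by apply: diamond_no_copy; lra.
- by apply: diamond_width; lra.
Qed.

(* Its lattice points all lie on [y = 0]; decreasing [d] dilates it about [(-1/3, 0)]. *)
Definition triangle (d : R) := polygon R [:: (-1, 2, 2 - d); (-1, -1, 2 - d); (2, -1, 1 - d)].

Lemma triangleP d x y : planar R (triangle d) x y <->
  [/\ 2 * y - x <= 2 - d, - x - y <= 2 - d & 2 * x - y <= 1 - d].
Proof.
rewrite /planar /triangle polygonP /= andbT; split.
  by move=> /and3P[*]; split; lra.
by move=> [*]; apply/and3P; split; lra.
Qed.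

Lemma triangle_lattice d (a b : int) : 0 < d -> planar R (triangle d) a%:~R b%:~R -> b = 0.
Proof.
move=> d0 /triangleP[h1 h2 h3].
have g1 : 2 * b - a < 2 by rewrite -(ltr_int R) !(rmorphB, rmorphM) /=; lra.
have g2 : - a - b < 2 by rewrite -(ltr_int R) !(rmorphB, rmorphN) /=; lra.
have g3 : 2 * a - b < 1 by rewrite -(ltr_int R) !(rmorphB, rmorphM) /=; lra.
clear - g1 g2 g3; lia.
Qed.

Lemma triangle_no_copy d : 0 < d -> ~ contains_copy AZ (@Delta2 R) (triangle d).
Proof.
move=> d0 /copy_triangle [x [y [p [q [r [s [un /(_ erefl) [a [b [-> ->]]]]]]]]]].
rewrite -!intrD => /(triangle_lattice _ _ _ d0) -> /(triangle_lattice _ _ _ d0) h1 /(triangle_lattice _ _ _ d0) h2.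
rewrite !add0r in h1 h2; subst r s; move: un; rewrite /unimodular !mulr0 subr0.
by case.
Qed.

(** At the centre [(-1/3, 0)] all three sides have slack 5/3, so [d = 5 / 3 * ep] means scaling by
    [1 - ep]. Up to sign, the edges are [5 / 3 * (1 - ep)] times [(2, 1)], [(1, 2)] and [(-1, 1)].
    If [2 * p + q], [p + 2 * q] and [q - p] were all at most 1 in absolute value, their combinations
    [3 * p] and [3 * q] would be at most 2 and hence 0. *)
Lemma triangle_width ep : 0 < ep -> ep < 1 ->
  ((10 / 3 * (1 - ep))%:E <= lattice_width (triangle (5 / 3 * ep)))%E.
Proof.
move=> ep0 ep1; apply: lattice_width_ge => u u0.
have inK x y : [/\ 2 * y - x <= 2 - 5 / 3 * ep, - x - y <= 2 - 5 / 3 * ep & 2 * x - y <= 1 - 5 / 3 * ep] ->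
  triangle (5 / 3 * ep) (rv R x y) by move/triangleP.
pose l := 1 - ep.
have v1 : triangle (5 / 3 * ep) (rv R (- (1 / 3) + 5 / 3 * l) (5 / 3 * l)) by apply: inK; rewrite /l; split; lra.
have v2 : triangle (5 / 3 * ep) (rv R (- (1 / 3) - 5 / 3 * l) 0) by apply: inK; rewrite /l; split; lra.
have v3 : triangle (5 / 3 * ep) (rv R (- (1 / 3)) (- (5 / 3 * l))) by apply: inK; rewrite /l; split; lra.
have step (a : int) (x : R) : (2 <= a) || (2 <= - a) -> x = a%:~R * (5 / 3 * l) -> 10 / 3 * l <= `|x|.
  move=> a2 ->; rewrite normrM (ger0_norm (_ : 0 <= 5 / 3 * l)); last by rewrite /l; lra.
  have : 2 <= `|a%:~R| :> R.
    by rewrite -intr_norm (ler_int R 2); case/orP: a2 => a2; lia.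
  have l0 : 0 <= 5 / 3 * l by rewrite /l; lra.
  by move=> /(ler_wpM2r l0); lra.
rewrite -/l.
set p := u 0 ord0; set q := u 0 (lift ord0 ord0).
have nz : ~ (p = 0 /\ q = 0).
  move=> [e1 e2]; move/eqP: u0; apply; apply/rowP => j; rewrite mxE.
  by case: (unliftP ord0 j) => [j' ->|->] //; rewrite (ord1 j').
have [a1|a1] := boolP ((2 <= 2 * p + q) || (2 <= - (2 * p + q))).
  exists (rv R (- (1 / 3) + 5 / 3 * l) (5 / 3 * l)), (rv R (- (1 / 3) - 5 / 3 * l) 0); split=> //.
  by apply: (step _ _ a1); rewrite !lin_rv -/p -/q rmorphD rmorphM /=; ring.
have [a2|a2] := boolP ((2 <= p + 2 * q) || (2 <= - (p + 2 * q))).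
  exists (rv R (- (1 / 3) + 5 / 3 * l) (5 / 3 * l)), (rv R (- (1 / 3)) (- (5 / 3 * l))); split=> //.
  by apply: (step _ _ a2); rewrite !lin_rv -/p -/q rmorphD rmorphM /=; ring.
have [a3|a3] := boolP ((2 <= q - p) || (2 <= - (q - p))).
  exists (rv R (- (1 / 3) - 5 / 3 * l) 0), (rv R (- (1 / 3)) (- (5 / 3 * l))); split=> //.
  by apply: (step _ _ a3); rewrite !lin_rv -/p -/q rmorphB /=; ring.
by case: nz; clear - a1 a2 a3; clearbody p q; split; lia.
Qed.

Lemma Flt_int_ge : ((10 / 3)%:E <= Flt AZ (@Delta2 R))%E.
Proof.
apply: Flt_ge => [ep ep0 ep1|]; last by rewrite divr_gt0.
exists (triangle (5 / 3 * ep)); split.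
- apply: (@polygon_convex_body R _ 10).
    by exists (rv R (- (1 / 3)) 0); apply/triangleP; split; lra.
  move=> z; rewrite [z]rv_eta => /triangleP[*]; rewrite rv0 rv1 !ler_norml.
  by split; apply/andP; split; lra.
- by apply: triangle_no_copy; lra.
- exact: triangle_width.
Qed.
End Extremal.

Theorem theorem1p1 (R : realType) :
  Flt AR (@Delta2 R) = (2%:R)%:E /\ Flt AZ (@Delta2 R) = (10%:R / 3%:R : R)%:E.
Proof.
split; apply/eqP; rewrite eq_le.
  by rewrite Flt_real_le Flt_real_ge.
by rewrite Flt_int_le Flt_int_ge.
Qed.
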